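(* Let $G=G_1\times\cdots\times G_n$ be any product of topological groups $G_i$, and let $X$ be a complete CAT(0) space with a continuous $G$-action by isometries. Then either the $G$-action is evanescent or there is a canonical non-empty closed convex $G$-invariant subspace $Z\subseteq X$ which splits $G$-equivariantly isometrically as a product $Z_1\times\cdots\times Z_n$ of $G_i$-spaces $Z_i$.
   Context: An isometric action of a topological group $G$ on a metric space $X$ is continuous if the map $G\times X\to X$ is continuous. A continuous isometric $G$-action on $X$ is evanescent if there is an unbounded set $T\subseteq X$ such that for every compact set $Q\subseteq G$ the set $\{d(gx,x):g\in Q,\ x\in T\}$ is bounded. The product $Z_1\times\cdots\times Z_n$ is endowed with the $\ell^2$-product metric and with the product action $(g_1,\ldots,g_n)(z_1,\ldots,z_n)=(g_1z_1,\ldots,g_nz_n)$, each $Z_i$ being a metric space with an isometric $G_i$-action. ''Canonical'' means determined by the action without arbitrary choices. *)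

(* Defs.v *)
(* MathComp-Analysis; R : realType plays the role of the real numbers. *)
From HB Require Import structures.
From mathcomp Require Import all_boot all_order all_algebra.
From mathcomp Require Import all_classical all_reals all_analysis.

Set Implicit Arguments.
Unset Strict Implicit.
Unset Printing Implicit Defensive.

Import Order.TTheory GRing.Theory Num.Theory.
Import numFieldNormedType.Exports.

Local Open Scope classical_set_scope.
Local Open Scope ring_scope.

(* The library only has topological groups in additive notation, which are
   abelian. No separation axiom is imposed. *)
HB.mixin Record Group_isTopologicalGroup G of Group G & Topological G := {
  mulg_continuous : continuous (fun p : G * G => (p.1 * p.2)%g) ;
  invg_continuous : continuous (fun g : G => g^-1%g)
}.

#[short(type="topGroupType")]
HB.structure Definition TopologicalGroup :=
  {G of Group G & Topological G & Group_isTopologicalGroup G}.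

Section ProductGroup.
Variables (I : eqType) (G : I -> topGroupType).
Local Notation P := (prod_topology G).

Let one : P := fun i => 1%g.
Let mul (g h : P) : P := fun i => (g i * h i)%g.
Let inv (g : P) : P := fun i => (g i)^-1%g.

Fact prod_mulgA : associative mul.
Proof. by move=> f g h; apply: functional_extensionality_dep => i; exact: mulgA. Qed.
Fact prod_mul1g : left_id one mul.
Proof. by move=> g; apply: functional_extensionality_dep => i; exact: mul1g. Qed.
Fact prod_mulg1 : right_id one mul.
Proof. by move=> g; apply: functional_extensionality_dep => i; exact: mulg1. Qed.
Fact prod_mulVg : left_inverse one inv mul.
Proof. by move=> g; apply: functional_extensionality_dep => i; exact: mulVg. Qed.
Fact prod_mulgV : right_inverse one inv mul.
Proof. by move=> g; apply: functional_extensionality_dep => i; exact: mulgV. Qed.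

HB.instance Definition _ := isGroup.Build P
  prod_mulgA prod_mul1g prod_mulg1 prod_mulVg prod_mulgV.

Fact prod_continuous (T : topologicalType) (f : T -> P) :
  (forall i, continuous (fun t => f t i)) -> continuous f.
Proof.
move=> fc t; apply/cvg_sup => i U.
have /= -> := @nbhsE (initial_topology (fun h : (forall i, G i) => h i)) (f t).
case=> B [[C oC <-] Cfti] /filterS; apply.
exact: (fc i t C (open_nbhs_nbhs (conj oC Cfti))).
Qed.

Fact prod_proj_continuous i : continuous (fun g : P => g i).
Proof. exact: (@proj_continuous I G i). Qed.

Fact prod_mulg_continuous : continuous (fun p : P * P => (p.1 * p.2)%g).
Proof.
apply: prod_continuous => i p.
apply: (@continuous_comp _ _ _ (fun p : P * P => (p.1 i, p.2 i))
  (fun q : G i * G i => (q.1 * q.2)%g)); last exact: mulg_continuous.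
apply: (@cvg_pair _ _ _ (nbhs p)).
  apply: (@continuous_comp _ _ _ fst (fun g : P => g i)); first exact: cvg_fst.
  exact: prod_proj_continuous.
apply: (@continuous_comp _ _ _ snd (fun g : P => g i)); first exact: cvg_snd.
exact: prod_proj_continuous.
Qed.

Fact prod_invg_continuous : continuous (fun g : P => g^-1%g).
Proof.
apply: prod_continuous => i g.
apply: (@continuous_comp _ _ _ (fun g : P => g i) (fun h : G i => h^-1%g)).
  exact: prod_proj_continuous.
exact: invg_continuous.
Qed.

HB.instance Definition _ := Group_isTopologicalGroup.Build P
  prod_mulg_continuous prod_invg_continuous.

End ProductGroup.

Definition l2norm (R : realType) (n : nat) (f : 'I_n -> R) : R :=
  Num.sqrt (\sum_i f i ^+ 2).

Section Metric.
Variable R : realType.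

(* The library's completeType is pointed by a chosen element; this is the same
   condition without the base point. *)
Definition complete_space (X : metricType R) : Prop :=
  forall F : set_system X, ProperFilter F -> cauchy F -> exists x : X, F --> x.

Definition metric_bounded (X : metricType R) (A : set X) : Prop :=
  exists M : R, forall x y, A x -> A y -> mdist x y <= M.

Definition geodesic_segment (X : metricType R) (x y : X) (S : set X) : Prop :=
  exists c : R -> X,
    [/\ c 0 = x, c (mdist x y) = y,
        forall s t, 0 <= s <= mdist x y -> 0 <= t <= mdist x y ->
          mdist (c s) (c t) = `|s - t|
      & S = [set c t | t in [set t | 0 <= t <= mdist x y]]].

Definition geodesic_space (X : metricType R) : Prop :=
  forall x y : X, exists S, geodesic_segment x y S.

Definition geodesically_convex (X : metricType R) (C : set X) : Prop :=
  forall x y S, C x -> C y -> geodesic_segment x y S -> S `<=` C.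

(* The library's norm on 'rV[R]_2 is the sup norm, hence an explicit Euclidean
   distance. *)
Definition eucl_dist (u v : 'rV[R]_2) : R := l2norm (fun i => u 0 i - v 0 i).

Definition eucl_segment (u v : 'rV[R]_2) : set 'rV[R]_2 :=
  [set (1 - t) *: u + t *: v | t in [set t : R | 0 <= t <= 1]].

(* q is the comparison point on [u, v] of the point p of the side S, a geodesic
   segment issuing from x. *)
Definition comparison_point (X : metricType R) (x : X) (S : set X)
    (u v : 'rV[R]_2) (p : X) (q : 'rV[R]_2) : Prop :=
  [/\ S p, eucl_segment u v q & eucl_dist u q = mdist x p].

Definition CAT0 (X : metricType R) : Prop :=
  geodesic_space X /\
  forall (x y z : X) (Sxy Syz Szx : set X) (u v w : 'rV[R]_2),
    geodesic_segment x y Sxy -> geodesic_segment y z Syz ->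
    geodesic_segment z x Szx ->
    eucl_dist u v = mdist x y -> eucl_dist v w = mdist y z ->
    eucl_dist w u = mdist z x ->
    let comparison p q :=
      [\/ comparison_point x Sxy u v p q,
          comparison_point y Syz v w p q
        | comparison_point z Szx w u p q] in
    forall p1 p2 q1 q2, comparison p1 q1 -> comparison p2 q2 ->
      mdist p1 p2 <= eucl_dist q1 q2.

Record isometric_action (G : groupType) (X : metricType R) := IsometricAction {
  act :> G -> X -> X ;
  act1 : forall x, act 1%g x = x ;
  actM : forall g h x, act (g * h)%g x = act g (act h x) ;
  act_isometry : forall g x y, mdist (act g x) (act g y) = mdist x y
}.

Definition continuous_action (G : topGroupType) (X : metricType R)
    (a : isometric_action G X) : Prop :=
  continuous (fun p : G * X => a p.1 p.2).

Definition evanescent (G : topGroupType) (X : metricType R)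
    (a : isometric_action G X) : Prop :=
  exists T : set X, ~ metric_bounded T /\
    forall Q : set G, compact Q ->
      bounded_set [set mdist (a g x) x | g in Q & x in T].

Definition invariant_set (G : groupType) (X : metricType R)
    (a : isometric_action G X) (Z : set X) : Prop :=
  forall g x, Z x -> Z (a g x).

Definition l2_dist (n : nat) (Y : 'I_n -> metricType R)
    (y z : forall i, Y i) : R :=
  l2norm (fun i => mdist (y i) (z i)).

Definition product_act (n : nat) (G : 'I_n -> topGroupType)
    (Y : 'I_n -> metricType R) (b : forall i, isometric_action (G i) (Y i))
    (g : prod_topology G) (y : forall i, Y i) : forall i, Y i :=
  fun i => b i (g i) (y i).

(* Only the restriction of f to Z matters. *)
Definition splits_equivariantly (n : nat) (G : 'I_n -> topGroupType)
    (X : metricType R) (a : isometric_action (prod_topology G) X)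
    (Z : set X) : Prop :=
  exists (Y : 'I_n -> metricType R)
         (b : forall i, isometric_action (G i) (Y i))
         (f : X -> forall i, Y i),
    [/\ set_bij Z [set: forall i, Y i] f,
        forall x y, Z x -> Z y -> l2_dist (f x) (f y) = mdist x y
      & forall g x, Z x -> f (a g x) = product_act b g (f x)].

Definition topological_group_iso (G H : topGroupType) (psi : G -> H) : Prop :=
  {morph psi : g h / (g * h)%g} /\
  exists psi' : H -> G,
    [/\ cancel psi psi', cancel psi' psi, continuous psi & continuous psi'].

Definition metric_iso (X Y : metricType R) (phi : X -> Y) : Prop :=
  bijective phi /\ forall x y, mdist (phi x) (phi y) = mdist x y.

Definition action_iso (G H : topGroupType) (X Y : metricType R)
    (a : isometric_action G X) (b : isometric_action H Y)
    (psi : G -> H) (phi : X -> Y) : Prop :=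
  [/\ topological_group_iso psi, metric_iso phi
    & forall g x, phi (a g x) = b (psi g) (phi x)].

Definition subset_assignment : Type :=
  forall (G : topGroupType) (X : metricType R), isometric_action G X -> set X.

(* Determined by the action without arbitrary choices: the assignment depends
   on the action alone and every isomorphism of actions carries the subset
   assigned to the first onto the subset assigned to the second. *)
Definition canonical_assignment (Z : subset_assignment) : Prop :=
  forall (G H : topGroupType) (X Y : metricType R)
    (a : isometric_action G X) (b : isometric_action H Y)
    (psi : G -> H) (phi : X -> Y),
    action_iso a b psi phi -> Z H Y b = phi @` Z G X a.

End Metric.

(* Main.v *)
(* If the action is not evanescent, then the projections of a point x to the
   invariant closed convex sets stay within bounded distance of x, because each
   of them is displaced at most as much as x; hence minimal invariant sets exist.
   Any two of them are parallel. An isometry of a minimal set that commutes with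
   the action has constant displacement, so its iterates would make the action
   evanescent unless it is the identity; hence the projections between minimal
   sets compose without holonomy. Therefore the minimal sets form a bounded
   metric space with a circumcentre, which is the canonical minimal set Z.

   Now fix a factor H = G_i, with complementary factor K. Minimal H-sets exist
   inside Z by the same argument applied to those points of Z that no element of
   K displaces more than x: an invariant set contained there controls the
   displacement by H through the projection and that by K by definition. The
   union of the minimal H-sets is closed, convex and invariant, hence equals Z,
   and Z splits as A_i times a transversal. K acts trivially on A_i as its
   elements induce isometries of A_i commuting with H. By minimality of Z, the
   maps Z -> A_i are jointly an isometry onto the l2-product. *)
Require Import Defs.
From HB Require Import structures.
From mathcomp Require Import all_boot all_order all_algebra.
From mathcomp Require Import all_classical all_reals all_analysis.
From mathcomp Require Import ring lra.
Set Implicit Arguments.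
Unset Strict Implicit.
Unset Printing Implicit Defensive.
Import Order.TTheory GRing.Theory Num.Theory.
Import numFieldNormedType.Exports.
Local Open Scope classical_set_scope.
Local Open Scope ring_scope.

(** * Geodesic points and comparison inequalities in CAT(0) spaces *)

Section Cat0Geometry.
Variables (R : realType) (X : metricType R).
Implicit Types (x y z m : X) (t : R) (A B C : set X).

Local Notation D := (@mdist R X).

Lemma sqr_le_le (a b : R) : 0 <= b -> a ^+ 2 <= b ^+ 2 -> a <= b.
Proof. by move=> b0 ab; nra. Qed.

Lemma le_le_sqr (a b : R) : 0 <= a -> a <= b -> a ^+ 2 <= b ^+ 2.
Proof. by move=> a0 ab; nra. Qed.

(** The point at ratio t of a geodesic, recorded by distances alone so that isometries preserve it
    without reference to a path. *)
Definition between t x y m := D x m = t * D x y /\ D m y = (1 - t) * D x y.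

Lemma between_sym t x y m : between t x y m -> between (1 - t) y x m.
Proof.
case=> xm my; split; first by rewrite metric_sym my (metric_sym x).
by rewrite metric_sym xm (metric_sym x) subKr.
Qed.

Definition mclosed A := forall x,
  (forall e, 0 < e -> exists2 y, A y & D x y < e) -> A x.

Lemma closed_mclosed A : mclosed A <-> closed A.
Proof.
split=> clA x.
  move=> Ax; apply: clA => e e0.
  have [y [Ay]] := Ax _ (nbhsx_ballx x e e0).
  by rewrite ballEmdist /=; exists y.
move=> Ax; apply: clA => U; rewrite -filter_from_ballE => -[e /= e0 eU].
have [y Ay xy] := Ax _ e0; exists y; split=> //; apply: eU.
by rewrite ballEmdist.
Qed.

Definition bconvex A := forall t x y m,
  A x -> A y -> 0 <= t <= 1 -> between t x y m -> A m.

Lemma bconvex_geodesically_convex A : bconvex A -> geodesically_convex A.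
Proof.
move=> cA x y S Ax Ay [c [c0 cd cdist ->]] _ [s /= sI <-].
have d0 : 0 <= D x y := mdist_ge0 _ _.
have dI : 0 <= D x y <= D x y by apply/andP; split.
have zI : (0 : R) <= 0 <= D x y by apply/andP; split.
have [xy0|xyN0] := eqVneq (D x y) 0.
  by rewrite xy0 -eq_le in sI; move/eqP: sI => <-; rewrite c0.
have d_gt0 : 0 < D x y by rewrite lt_neqAle eq_sym xyN0.
apply: (cA (s / D x y) _ _ _ Ax Ay).
  by case/andP: sI => s0 s1; rewrite divr_ge0// ler_pdivrMr// mul1r.
case/andP: (sI) => s0 s1; split.
  by rewrite divfK// -[X in D X _]c0 cdist// sub0r normrN ger0_norm.
rewrite -[X in D _ X]cd cdist// mulrBl mul1r divfK//.
by rewrite distrC ger0_norm// subr_ge0.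
Qed.

Hypothesis catX : CAT0 X.

Let vec (a b : R) : 'rV[R]_2 := \row_i (if i == 0 then a else b).

Let eucl_distE a b a' b' :
  eucl_dist (vec a b) (vec a' b') = Num.sqrt ((a - a') ^+ 2 + (b - b') ^+ 2).
Proof. by rewrite /eucl_dist /l2norm !big_ord_recl big_ord0 !mxE/= addr0. Qed.

Let sqrtE (a b : R) : 0 <= b -> a = b ^+ 2 -> Num.sqrt a = b.
Proof. by move=> b0 ->; rewrite sqrtr_sqr ger0_norm. Qed.

(** Stewart's identity in the comparison triangle turns the CAT(0) condition, for z and a point of
    the opposite side, into this quadratic inequality, the only form used afterwards. *)
Lemma cat0_between_exists t x y : 0 <= t <= 1 ->
  exists2 m, between t x y m &
    forall z, D z m ^+ 2 <=
      (1 - t) * D z x ^+ 2 + t * D z y ^+ 2 - t * (1 - t) * D x y ^+ 2.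
Proof.
move=> /andP[t0 t1].
have d0 : 0 <= D x y := mdist_ge0 _ _.
have [xy0|xyN0] := eqVneq (D x y) 0.
  exists x; first by rewrite /between mdistxx xy0 !mulr0.
  by move=> z; rewrite -(mdist_positivity _ _ xy0) mdistxx; nra.
have d_gt0 : 0 < D x y by rewrite lt_neqAle eq_sym xyN0.
have [Sxy Sxyg] := catX.1 x y; have [c [c0 cd cdist SE]] := Sxyg.
have tI : 0 <= t * D x y <= D x y.
  by rewrite mulr_ge0//= ger_pMl.
have dI : 0 <= D x y <= D x y by apply/andP; split.
have zI : (0 : R) <= 0 <= D x y by apply/andP; split.
have xm : D x (c (t * D x y)) = t * D x y.
  rewrite -[X in D X _]c0 cdist// sub0r normrN ger0_norm//.
  by case/andP: tI.
have my : D (c (t * D x y)) y = (1 - t) * D x y.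
  rewrite -[X in D _ X]cd cdist// distrC ger0_norm ?subr_ge0; last first.
    by case/andP: tI.
  by rewrite mulrBl mul1r.
exists (c (t * D x y)) => [//|z].
have [Syz Syzg] := catX.1 y z; have [Szx Szxg] := catX.1 z x.
have := metric_triangle y x z; have := metric_triangle x y z.
have := metric_triangle x z y.
have := mdist_ge0 z x; have := mdist_ge0 z y.
rewrite (metric_sym y x) (metric_sym y z) (metric_sym x z).
set m := c _ in xm my *.
set d := D x y in d0 xyN0 d_gt0 tI dI zI xm my *.
set p := D z x; set q := D z y => q0 p0 T1 T2 T3.
(* The comparison triangle has vertices (0,0), (d,0), (a,b) for x, y, z; [a] comes from the law of
   cosines, and the triangle inequalities bound it by [p] in absolute value, so that [b] exists. *)
pose a := (d ^+ 2 + p ^+ 2 - q ^+ 2) / (2 * d).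
have ad : 2 * (a * d) = d ^+ 2 + p ^+ 2 - q ^+ 2 by rewrite /a; field.
have bp : 0 <= p ^+ 2 - a ^+ 2.
  have h1 : a <= p by rewrite -(ler_pM2r d_gt0); nra.
  have h2 : - p <= a by rewrite -(ler_pM2r d_gt0); nra.
  by nra.
pose b := Num.sqrt (p ^+ 2 - a ^+ 2).
have b2 : b ^+ 2 = p ^+ 2 - a ^+ 2 by rewrite sqr_sqrtr.
have segE u v s : (1 - s) *: vec u 0 + s *: vec v 0 = vec ((1 - s) * u + s * v) 0.
  apply/rowP => i; rewrite !mxE; case: ifP => //= _.
  by rewrite !mulr0 addr0.
have H := catX.2 x y z Sxy Syz Szx (vec 0 0) (vec d 0) (vec a b) Sxyg Syzg Szxg.
have {}H : D m z <= eucl_dist (vec (t * d) 0) (vec a b).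
  apply: H.
  - by rewrite eucl_distE -/d; apply: sqrtE => //; ring.
  - rewrite eucl_distE; apply: sqrtE; first exact: mdist_ge0.
    by rewrite metric_sym -/q sub0r sqrrN b2; nra.
  - by rewrite eucl_distE -/p; apply: sqrtE => //; rewrite !subr0 b2; ring.
  - apply: Or31; split.
    + by rewrite SE; exists (t * d).
    + exists t; rewrite /= ?t0//; rewrite segE; congr vec; ring.
    + rewrite xm eucl_distE; apply: sqrtE; last ring.
      by case/andP: tI.
  - apply: Or33; split.
    + by case: Szxg => c' [c'0 _ _ ->]; exists 0 => //=; rewrite lexx mdist_ge0.
    + by exists 0; rewrite /= ?lexx ?ler01// subr0 scale1r scale0r addr0.
    + by rewrite eucl_distE mdistxx; apply: sqrtE => //; ring.
rewrite metric_sym.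
have e0 : 0 <= eucl_dist (vec (t * d) 0) (vec a b) by exact: sqrtr_ge0.
have e2 : eucl_dist (vec (t * d) 0) (vec a b) ^+ 2 =
    (t * d - a) ^+ 2 + b ^+ 2.
  by rewrite eucl_distE sqr_sqrtr ?sub0r ?sqrrN// addr_ge0// sqr_ge0.
have m0 : 0 <= D m z := mdist_ge0 _ _.
have {}H : D m z ^+ 2 <= (t * d - a) ^+ 2 + b ^+ 2.
  by rewrite -e2 ler_sqr.
apply: (le_trans H); rewrite b2 le_eqVlt; apply/orP; left; apply/eqP.
transitivity (t^+2 * d^+2 - t * (2 * (a * d)) + p ^+2); first by ring.
by rewrite ad; ring.
Qed.

(** The inequality for the constructed point, tested at z = m, shows that m is that point. *)
Lemma cat0_ineq t x y m z : 0 <= t <= 1 -> between t x y m ->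
  D z m ^+ 2 <=
    (1 - t) * D z x ^+ 2 + t * D z y ^+ 2 - t * (1 - t) * D x y ^+ 2.
Proof.
move=> tI [xm my]; have [m' _ H] := cat0_between_exists x y tI.
suff -> : m = m' by exact: H.
apply: mdist_positivity; apply/eqP; rewrite -sqrf_eq0.
rewrite eq_le sqr_ge0 andbT; apply: (le_trans (H m)).
by rewrite my (metric_sym m x) xm; nra.
Qed.

Lemma between_unique t x y m m' : 0 <= t <= 1 ->
  between t x y m -> between t x y m' -> m = m'.
Proof.
move=> tI xm [xm' my']; have := cat0_ineq m' tI xm.
rewrite my' (metric_sym m' x) xm' => H.
apply/esym/mdist_positivity/eqP; rewrite -sqrf_eq0 eq_le sqr_ge0 andbT.
by apply: (le_trans H); nra.
Qed.

Lemma between_exists t x y : 0 <= t <= 1 -> exists m, between t x y m.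
Proof. by move=> /(cat0_between_exists x y)[m]; exists m. Qed.

Lemma between_dist_common t x y y' m m' : 0 <= t <= 1 ->
  between t x y m -> between t x y' m' -> D m m' <= t * D y y'.
Proof.
move=> tI xm xm'; have [xm1 my1] := xm'; case/andP: (tI) => t0 t1.
have H1 := cat0_ineq m' tI xm; have H2 := cat0_ineq y tI xm'.
apply: sqr_le_le; first by rewrite mulr_ge0// mdist_ge0.
rewrite (metric_sym m' x) xm1 in H1.
rewrite (metric_sym y x) in H2.
rewrite (metric_sym m m').
have := ler_wpM2l t0 H2; rewrite (metric_sym y m') in H2 *.
by nra.
Qed.

(* Through the point dividing the diagonal from x to y' in the ratio t. *)
Lemma between_dist t x y x' y' m m' : 0 <= t <= 1 ->
  between t x y m -> between t x' y' m' ->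
  D m m' <= (1 - t) * D x x' + t * D y y'.
Proof.
move=> tI xm xm'; have [n xn] := between_exists x y' tI.
have tI' : 0 <= 1 - t <= 1 by rewrite lerBlDr lerDl; lra.
apply: (le_trans (metric_triangle m n m')); rewrite addrC lerD//.
  exact: between_dist_common (between_sym xn) (between_sym xm').
exact: between_dist_common xm xn.
Qed.

(** Both ends of one diagonal are compared with the midpoint of the other. *)
Lemma quadrilateral x y z w :
  D x z ^+ 2 + D y w ^+ 2 <=
  D x y ^+ 2 + D y z ^+ 2 + D z w ^+ 2 + D w x ^+ 2.
Proof.
have hI : 0 <= (2^-1 : R) <= 1 by lra.
have [m ym] := between_exists y w hI.
have H1 := cat0_ineq x hI ym; have H2 := cat0_ineq z hI ym.
have H3 := metric_triangle x m z; rewrite (metric_sym m z) in H3.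
rewrite (metric_sym y z) (metric_sym w x).
have := mdist_ge0 x z; have := mdist_ge0 x m; have := mdist_ge0 z m.
move=> zm0 xm0 xz0.
have H4 : D x z ^+ 2 <= 2 * (D x m ^+ 2 + D z m ^+ 2).
  have := sqr_ge0 (D x m - D z m); nra.
by nra.
Qed.

End Cat0Geometry.

(** * Nearest-point projections and existence of minimal invariant sets *)

Section Projection.
Variables (R : realType) (X : metricType R).
Hypotheses (completeX : complete_space X) (catX : CAT0 X).
Implicit Types (x y z m p : X) (t : R) (A B C : set X).

Local Notation D := (@mdist R X).

(** The sets are a Cauchy filter base and p is its limit; families indexed by tolerances or by
    chains of sets are thus handled without choosing sequences. *)
Lemma complete_family (I : Type) (P : set I) (S : I -> set X) :
  P !=set0 -> (forall i, P i -> S i !=set0) ->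
  (forall i j, P i -> P j -> exists2 k, P k & S k `<=` S i `&` S j) ->
  (forall e, 0 < e -> exists2 i, P i & forall x y, S i x -> S i y -> D x y < e) ->
  exists p, forall i, P i -> forall e, 0 < e -> exists2 y, S i y & D p y < e.
Proof.
move=> P0 S0 Sdir Ssmall.
have FF : Filter (filter_from P S) by exact: filter_from_filter.
have PF : ProperFilter (filter_from P S) by exact: filter_from_proper.
have [|p Fp] := completeX PF.
  apply: cauchy_exP => e e0; have [i Pi Si] := Ssmall e e0.
  have [x Sx] := S0 i Pi; exists x, i => // y Sy.
  by rewrite ballEmdist; exact: Si.
exists p => i Pi e e0.
have [j Pj Sj] : filter_from P S (ball p e) by apply: Fp; exact: nbhsx_ballx.
have [k Pk Sk] := Sdir i j Pi Pj; have [y Sy] := S0 k Pk.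
have [Siy Sjy] := Sk y Sy; exists y => //.
by have := Sj y Sjy; rewrite ballEmdist.
Qed.

(** The obtuse-angle form of being nearest: it contains minimality of the distance and,
    quantitatively, uniqueness. *)
Definition is_proj A x p :=
  A p /\ forall c, A c -> D x p ^+ 2 + D p c ^+ 2 <= D x c ^+ 2.

Definition proj A x := xget x (is_proj A x).

Definition ccvx A := [/\ A !=set0, mclosed A & bconvex A].

(* Compare x with points of the geodesic from p to c that tend to p. *)
Lemma is_proj_min A x p : bconvex A -> A p ->
  (forall c, A c -> D x p <= D x c) -> is_proj A x p.
Proof.
move=> cA Ap pmin; split=> // c Ac; rewrite leNgt; apply/negP => lt_s.
set s := D x p ^+ 2 + D p c ^+ 2 - D x c ^+ 2.
have s0 : 0 < s by rewrite subr_gt0.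
have q0 : 0 <= D p c ^+ 2 by exact: sqr_ge0.
have sq0 : 0 < s + D p c ^+ 2 by lra.
set t := s / (s + D p c ^+ 2).
have tE : t * (s + D p c ^+ 2) = s by rewrite divfK// gt_eqF.
have t_gt0 : 0 < t by rewrite divr_gt0.
have tI : 0 <= t <= 1 by rewrite (ltW t_gt0) ler_pdivrMr// mul1r lerDl.
have [m pm] := between_exists catX p c tI.
have H2 := cat0_ineq catX x tI pm.
have H1 := le_le_sqr (mdist_ge0 _ _) (pmin m (cA _ _ _ _ Ap Ac tI pm)).
have H3 : t * (D x p ^+ 2 + (1 - t) * D p c ^+ 2) <= t * D x c ^+ 2.
  by move: (le_trans H1 H2); lra.
rewrite ler_pM2l// in H3.
have : s <= t * D p c ^+ 2 by rewrite /s; lra.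
have : 0 < t * s by rewrite mulr_gt0.
by move: tE; lra.
Qed.

(** Almost nearest points cluster: the midpoint of two of them lies in A and would otherwise be
    closer to x than the infimum. *)
Lemma is_proj_exists A x : ccvx A -> exists p, is_proj A x p.
Proof.
move=> [[a Aa] clA cA].
pose E := [set D x c | c in A].
have Einf : has_inf E.
  by split; [exists (D x a), a | exists 0 => _ [c _ <-]; exact: mdist_ge0].
have infE c : A c -> inf E <= D x c.
  by move=> Ac; apply: ge_inf; [case: Einf|exists c].
have d0 : 0 <= inf E.
  by apply: lb_le_inf; [case: Einf|move=> _ [c _ <-]; exact: mdist_ge0].
have [||||p Hp] := @complete_family R [set e | 0 < e]
    (fun e => [set c | A c /\ D x c < inf E + e]).
- by exists 1; rewrite /= ltr01.
- move=> e /= e0; have [_ [c Ac <-] xc] := inf_adherent e0 Einf.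
  by exists c.
- move=> e e' /= e0 e'0; exists (Num.min e e'); first by rewrite /= lt_min e0.
  move=> c [Ac]; rewrite -ltrBlDl lt_min => /andP[].
  by rewrite !ltrBlDl.
- move=> r r0.
  (* The midpoint inequality gives [D c c' ^+ 2 <= 4 * e * (2 * inf E + e)], which this choice keeps
     below [r ^+ 2]. *)
  have e_gt0 : 0 < Num.min 1 (r ^+ 2 / (4 * (2 * inf E + 2))).
    by rewrite lt_min ltr01 divr_gt0// ?exprn_gt0//; lra.
  set e := Num.min _ _ in e_gt0 *.
  have e1 : e <= 1 by rewrite ge_min lexx.
  have er : e * (4 * (2 * inf E + 2)) <= r ^+ 2.
    by rewrite -ler_pdivlMr ?ge_min ?lexx ?orbT//; lra.
  exists e => // c c' [Ac xc] [Ac' xc'].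
  have hI : 0 <= (2^-1 : R) <= 1 by lra.
  have [m cm] := between_exists catX c c' hI.
  have H2 := cat0_ineq catX x hI cm.
  have H1 := le_le_sqr d0 (infE m (cA _ _ _ _ Ac Ac' hI cm)).
  have K1 : D x c ^+ 2 <= (inf E + e) ^+ 2.
    exact: le_le_sqr (mdist_ge0 _ _) (ltW _).
  have K2 : D x c' ^+ 2 <= (inf E + e) ^+ 2.
    exact: le_le_sqr (mdist_ge0 _ _) (ltW _).
  rewrite -ltr_sqr ?nnegrE ?mdist_ge0 ?(ltW r0)//.
  have {}H2 : D c c' ^+ 2 <= 4 * e * (2 * inf E + e) by lra.
  apply: (le_lt_trans H2); apply: lt_le_trans er.
  have : e * e <= e * 1 by rewrite ler_pM2l.
  lra.
have Ap : A p.
  apply: clA => e e0; have [y [Ay _] py] := Hp 1 ltr01 e e0.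
  by exists y.
exists p; apply: is_proj_min => // c Ac; apply: le_trans (infE c Ac).
apply/ler_addgt0Pl => e e0; have e2 : 0 < e / 2 by rewrite divr_gt0.
have [y [Ay xy] py] := Hp (e / 2) e2 (e / 2) e2.
have := metric_triangle x y p; rewrite (metric_sym y p); lra.
Qed.

Lemma projP A x : ccvx A -> is_proj A x (proj A x).
Proof. by move=> /(is_proj_exists x)/(xgetPex x). Qed.

Lemma proj_in A x : ccvx A -> A (proj A x).
Proof. by move=> /(projP x)[]. Qed.

Lemma proj_pyth A x c : ccvx A -> A c ->
  D x (proj A x) ^+ 2 + D (proj A x) c ^+ 2 <= D x c ^+ 2.
Proof. by move=> /(projP x)[_ +]; exact. Qed.

Lemma proj_le A x c : ccvx A -> A c -> D x (proj A x) <= D x c.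
Proof.
move=> cA Ac; apply: sqr_le_le (mdist_ge0 _ _) _.
by have := proj_pyth x cA Ac; have := sqr_ge0 (D (proj A x) c); lra.
Qed.

Lemma proj_eq_min A x p : ccvx A -> A p -> (forall c, A c -> D x p <= D x c) ->
  proj A x = p.
Proof.
move=> cA Ap pmin; have H := proj_pyth x cA Ap.
apply/mdist_positivity/eqP; rewrite -sqrf_eq0 eq_le sqr_ge0 andbT.
by have := le_le_sqr (mdist_ge0 _ _) (pmin _ (proj_in x cA)); lra.
Qed.

Lemma proj_id A x : ccvx A -> A x -> proj A x = x.
Proof.
by move=> cA Ax; apply: proj_eq_min => // c _; rewrite mdistxx mdist_ge0.
Qed.

(** The Pythagorean inequalities of the two projections add up against [quadrilateral]. *)
Lemma proj_nonexpansive A x y : ccvx A -> D (proj A x) (proj A y) <= D x y.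
Proof.
move=> cA; have H1 := proj_pyth x cA (proj_in y cA).
have H2 := proj_pyth y cA (proj_in x cA).
have H3 := quadrilateral catX x y (proj A y) (proj A x).
rewrite (metric_sym (proj A x) x) in H3.
rewrite (metric_sym (proj A y) (proj A x)) in H2 H3.
by apply: sqr_le_le (mdist_ge0 _ _) _; lra.
Qed.

Lemma proj_isometry_image A B (h : X -> X) x : ccvx A -> ccvx B ->
  (forall y z, D (h y) (h z) = D y z) -> (forall c, A c -> B (h c)) ->
  (forall c, B c -> exists2 c', A c' & h c' = c) ->
  proj B (h x) = h (proj A x).
Proof.
move=> cA cB hi AB BA; apply: proj_eq_min => //; first by apply: AB; exact: proj_in.
by move=> _ /BA[c Ac <-]; rewrite !hi; exact: proj_le.
Qed.

(** Distances from x grow as the sets shrink but stay below r, so they approach a supremum;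
    [proj_pyth] then makes the projections of x Cauchy along the chain. *)
Lemma chain_meet (I : Type) (P : set I) (C : I -> set X) x r :
  P !=set0 -> (forall i, P i -> ccvx (C i)) ->
  (forall i j, P i -> P j -> C i `<=` C j \/ C j `<=` C i) ->
  (forall i, P i -> D x (proj (C i) x) <= r) ->
  exists p, forall i, P i -> C i p.
Proof.
move=> P0 cC tot Cr.
pose E := [set D x (proj (C i) x) | i in P].
have Esup : has_sup E.
  split; first by case: P0 => i Pi; exists (D x (proj (C i) x)), i.
  by exists r => _ [i Pi <-]; exact: Cr.
have supE i : P i -> D x (proj (C i) x) <= sup E.
  by move=> Pi; apply: ub_le_sup; [case: Esup|exists i].
have d0 : 0 <= sup E.
  by case: P0 => i /supE; apply: le_trans; exact: mdist_ge0.
have anti i j : P i -> P j -> C i `<=` C j ->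
    D (proj (C i) x) (proj (C j) x) ^+ 2 <=
    D x (proj (C i) x) ^+ 2 - D x (proj (C j) x) ^+ 2.
  move=> Pi Pj ij; rewrite lerBrDl (metric_sym (proj (C i) x)).
  by apply: (proj_pyth x (cC j Pj)); apply: ij; exact: proj_in (cC i Pi).
have [|||p Hp] := @complete_family I P
    (fun i => [set p | exists j, [/\ P j, C j `<=` C i & p = proj (C j) x]]) P0.
- by move=> i Pi; exists (proj (C i) x); exists i; split.
- move=> i j Pi Pj; have [ij|ji] := tot i j Pi Pj.
    exists i => // _ [k [Pk ki ->]]; split; exists k; split=> //.
    exact: subset_trans ij.
  exists j => // _ [k [Pk kj ->]]; split; exists k; split=> //.
  exact: subset_trans ji.
- move=> e e0.
  (* The difference of squares is at most the gap to the supremum times [2 * sup E]; the [+ 1]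
     covers a zero supremum. *)
  have eta0 : 0 < e ^+ 2 / (2 * sup E + 1) by rewrite divr_gt0 ?exprn_gt0//; lra.
  have [_ [i Pi <-] iE] := sup_adherent eta0 Esup; exists i => //.
  set eta := e ^+ 2 / _ in eta0 iE.
  have etaE : eta * (2 * sup E + 1) = e ^+ 2 by rewrite divfK// gt_eqF//; lra.
  have small j k : P j -> P k -> C j `<=` C i -> C k `<=` C i ->
      C j `<=` C k -> D (proj (C j) x) (proj (C k) x) < e.
    move=> Pj Pk ji ki jk.
    rewrite -ltr_sqr ?nnegrE ?mdist_ge0 ?(ltW e0)//.
    apply: (le_lt_trans (anti _ _ Pj Pk jk)).
    have kE := supE k Pk; have jE := supE j Pj.
    have ik : D x (proj (C i) x) <= D x (proj (C k) x).
      by apply: (proj_le x (cC i Pi)); apply: ki; exact: proj_in (cC k Pk).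
    have := mdist_ge0 x (proj (C k) x); have := mdist_ge0 x (proj (C j) x).
    by move=> ? ?; nra.
  move=> _ _ [j [Pj ji ->]] [k [Pk ki ->]].
  have [jk|kj] := tot j k Pj Pk; first exact: small.
  by rewrite metric_sym; exact: small.
exists p => i Pi; have [_ clC _] := cC i Pi; apply: clC => e e0.
have [y [j [Pj ji ->]] py] := Hp i Pi e e0.
by exists (proj (C j) x) => //; apply: ji; exact: proj_in (cC j Pj).
Qed.

Definition inv_under (H : set (X -> X)) A := forall h x, H h -> A x -> A (h x).

Definition minimal_inv (H : set (X -> X)) A :=
  [/\ ccvx A, inv_under H A
    & forall B, ccvx B -> inv_under H B -> B `<=` A -> A `<=` B].

(** Zorn's lemma for reverse inclusion; the bound r keeps the intersection of a chain non-empty,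
    through [chain_meet]. *)
Lemma minimal_inv_exists H C0 x r : ccvx C0 -> inv_under H C0 ->
  (forall C, ccvx C -> inv_under H C -> C `<=` C0 -> D x (proj C x) <= r) ->
  exists2 A, minimal_inv H A & A `<=` C0.
Proof.
move=> cC0 iC0 Cr.
pose T := {C : set X | [/\ ccvx C, inv_under H C & C `<=` C0]}.
pose mk (C : set X) cC iC CC0 : T :=
  exist (fun C => [/\ ccvx C, inv_under H C & C `<=` C0]) C (And3 cC iC CC0).
pose T0 : T := mk C0 cC0 iC0 (@subset_refl _ C0).
pose le (s t : T) := `[< sval t `<=` sval s >].
have [||S totS|[A [cA iA AC0]] Amax] := @ZL_preorder T T0 le.
- by move=> s; apply/asboolP.
- by move=> r' s t /asboolP rs /asboolP st; apply/asboolP; exact: subset_trans st rs.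
- have [-> |/set0P S0] := eqVneq S set0; first by exists T0.
  have Sprop s : S s -> [/\ ccvx (sval s), inv_under H (sval s) & sval s `<=` C0].
    by case: s.
  have [|||p Hp] := @chain_meet T S (fun s => sval s) x r S0.
  + by move=> s /Sprop[].
  + by move=> s t Ss St; have [/asboolP ?|/asboolP ?] := totS s t Ss St; [right|left].
  + by move=> s /Sprop[cs is_ s0]; exact: Cr.
  have ccB : ccvx [set y | forall s, S s -> sval s y].
    split; first by exists p.
      move=> y Hy s Ss; have [[_ cl _] _ _] := Sprop s Ss; apply: cl => e e0.
      by have [z Hz yz] := Hy e e0; exists z => //; exact: Hz.
    move=> t y z m Hy Hz tI ym s Ss; have [[_ _ cv] _ _] := Sprop s Ss.
    by apply: cv tI ym; [exact: Hy|exact: Hz].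
  have iB : inv_under H [set y | forall s, S s -> sval s y].
    by move=> h y Hh Hy s Ss; have [_ i_ _] := Sprop s Ss; apply: i_ => //; exact: Hy.
  have BC0 : [set y | forall s, S s -> sval s y] `<=` C0.
    by case: S0 => s Ss y /(_ s Ss); have [_ _] := Sprop s Ss; exact.
  exists (mk _ ccB iB BC0) => s Ss; apply/asboolP => y /=.
  exact.
- exists A => //; split=> // B cB iB BA.
  by have /asboolP := Amax (mk B cB iB (subset_trans BA AC0)) (introT (asboolP _) BA).
Qed.

(* A sublevel set is closed, convex and invariant. *)
Lemma minimal_inv_const H A (phi : X -> R) L : minimal_inv H A ->
  (forall x y, A x -> A y -> `|phi x - phi y| <= L * D x y) ->
  (forall t x y m, A x -> A y -> 0 <= t <= 1 -> between t x y m ->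
     phi m <= (1 - t) * phi x + t * phi y) ->
  (forall h x, H h -> A x -> phi (h x) <= phi x) ->
  forall x y, A x -> A y -> phi x = phi y.
Proof.
move=> [[A0 clA cA] iA Amin] phiL phic phih.
suff le x y : A x -> A y -> phi y <= phi x.
  by move=> x y Ax Ay; apply/eqP; rewrite eq_le !le.
move=> Ax Ay.
suff /(_ y Ay)[] : A `<=` [set z | A z /\ phi z <= phi x] by [].
apply: Amin => [||z []//]; last first.
  move=> h z Hh [Az zx]; split; first exact: iA.
  by apply: le_trans zx; exact: phih.
split; first by exists x.
  move=> z Hz; have Az : A z.
    by apply: clA => e e0; have [w [Aw _] zw] := Hz e e0; exists w.
  split=> //; apply/ler_addgt0Pl => e e0.
  have L0 : 0 < `|L| + 1 by have := normr_ge0 L; lra.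
  have [|w [Aw wx] zw] := Hz (e / (`|L| + 1)); first by rewrite divr_gt0.
  have := phiL z w Az Aw; have := ler_norm (phi z - phi w).
  have : L * D z w <= e.
    rewrite ltr_pdivlMr// in zw; apply: le_trans (ltW zw).
    rewrite mulrC ler_wpM2l ?mdist_ge0//; have := ler_norm L; lra.
  lra.
move=> t z w m [Az zx] [Aw wx] tI zm; split; first exact: cA tI zm.
by apply: (le_trans (phic _ _ _ _ Az Aw tI zm)); case/andP: tI => t0 t1; nra.
Qed.

End Projection.

(** * Parallelism of minimal sets *)

Section MinimalSets.
Variables (R : realType) (X : metricType R).
Hypotheses (completeX : complete_space X) (catX : CAT0 X).
Implicit Types (x y z m p : X) (t : R) (A B C Z : set X) (H K : set (X -> X)).

Local Notation D := (@mdist R X).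

Definition isometric_on (Y : metricType R) A (s : X -> Y) :=
  forall x y, A x -> A y -> mdist (s x) (s y) = D x y.

Definition commutes_on A H (s : X -> X) :=
  forall h x, H h -> A x -> s (h x) = h (s x).

Definition isometries H := forall h, H h ->
  isometric_on setT h /\ exists2 h', H h' & cancel h h' /\ cancel h' h.

Lemma between_isometric (Y : metricType R) A (s : X -> Y) t x y m :
  isometric_on A s -> A x -> A y -> A m ->
  between t x y m -> between t (s x) (s y) (s m).
Proof. by move=> si Ax Ay Am [xm my]; split; rewrite !si. Qed.

Lemma proj_equivariant H A h x : isometries H -> ccvx A -> inv_under H A ->
  H h -> proj A (h x) = h (proj A x).
Proof.
move=> iH cA iA Hh; have [hi [h' Hh' [hK h'K]]] := iH h Hh.
apply: (proj_isometry_image completeX catX) => //.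
- by move=> y z; exact: hi.
- by move=> c; exact: iA.
- by move=> c Ac; exists (h' c); [exact: iA|rewrite h'K].
Qed.

Lemma dist_proj_lipschitz B x y : ccvx B ->
  `|D x (proj B x) - D y (proj B y)| <= 1 * D x y.
Proof.
move=> cB; rewrite mul1r ler_norml.
have := proj_le completeX catX x cB (proj_in completeX catX y cB).
have := proj_le completeX catX y cB (proj_in completeX catX x cB).
have := metric_triangle x y (proj B y); have := metric_triangle y x (proj B x).
rewrite (metric_sym y x); lra.
Qed.

Lemma dist_proj_convex B t x y m : ccvx B -> 0 <= t <= 1 -> between t x y m ->
  D m (proj B m) <= (1 - t) * D x (proj B x) + t * D y (proj B y).
Proof.
move=> cB tI xm.
have [n xn] := between_exists catX (proj B x) (proj B y) tI.
apply: le_trans (between_dist catX tI xm xn); apply: proj_le => //.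
by case: (cB) => _ _ cv; apply: cv tI xn; exact: proj_in.
Qed.

(** The distance to B is 1-Lipschitz, convex and invariant under H, so [minimal_inv_const]
    applies. *)
Lemma dist_proj_const H A B x y : isometries H -> minimal_inv H A ->
  ccvx B -> inv_under H B -> A x -> A y -> D x (proj B x) = D y (proj B y).
Proof.
move=> iH mA cB iB Ax Ay.
apply: (@minimal_inv_const _ _ H A (fun z => D z (proj B z)) 1 mA) Ax Ay.
- by move=> ? ? _ _; exact: dist_proj_lipschitz.
- by move=> s u v w _ _; exact: dist_proj_convex.
- by move=> h z Hh _; rewrite (proj_equivariant _ iH)// (iH h Hh).1.
Qed.

Lemma displacement_const H A (s : X -> X) x y : isometries H -> minimal_inv H A ->
  isometric_on A s -> commutes_on A H s -> A x -> A y -> D (s x) x = D (s y) y.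
Proof.
move=> iH mA si sH Ax Ay; have [[_ _ cA] iA _] := mA.
apply: (@minimal_inv_const _ _ H A (fun z => D (s z) z) 2 mA) Ax Ay.
- move=> u v Au Av; rewrite ler_norml; have := si u v Au Av.
  have := metric_triangle (s u) (s v) u; have := metric_triangle (s v) v u.
  have := metric_triangle (s v) (s u) v; have := metric_triangle (s u) u v.
  rewrite (metric_sym (s v) (s u)) (metric_sym v u); lra.
- move=> t u v w Au Av tI uw; have Aw := cA _ _ _ _ Au Av tI uw.
  exact: (between_dist catX tI (between_isometric si Au Av Aw uw) uw).
- by move=> h z Hh Az; rewrite sH// (iH h Hh).1.
Qed.

(** As the distance to B is constant on A, no point of A is closer to [proj B x] than x itself. *)
Lemma proj_minimalK H A B x : isometries H ->
  minimal_inv H A -> minimal_inv H B -> A x -> proj A (proj B x) = x.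
Proof.
move=> iH mA [cB iB _] Ax; have [cA _ _] := mA.
apply: (proj_eq_min completeX catX cA Ax) => c Ac.
rewrite metric_sym (dist_proj_const iH mA cB iB Ax Ac) (metric_sym _ c).
by apply: proj_le => //; exact: proj_in.
Qed.

Lemma proj_minimal_isometric H A B : isometries H ->
  minimal_inv H A -> minimal_inv H B -> isometric_on A (proj B).
Proof.
move=> iH mA mB x y Ax Ay; apply/eqP; rewrite eq_le; apply/andP; split.
  by apply: proj_nonexpansive => //; case: mB.
rewrite -{1}(proj_minimalK iH mA mB Ax) -{1}(proj_minimalK iH mA mB Ay).
by apply: proj_nonexpansive => //; case: mA.
Qed.

(** One inequality is [proj_pyth]. The reverse is [quadrilateral] for x, [proj A b], b, [proj B x],
    whose opposite sides have equal lengths. *)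
Lemma minimal_pythagoras H A B x b : isometries H ->
  minimal_inv H A -> minimal_inv H B -> A x -> B b ->
  D x b ^+ 2 = D x (proj B x) ^+ 2 + D (proj B x) b ^+ 2.
Proof.
move=> iH mA mB Ax Bb; have [cA iA _] := mA; have [cB iB _] := mB.
apply/eqP; rewrite eq_le proj_pyth// andbT.
set y := proj A b; have Ay : A y by exact: proj_in.
have yb : proj B y = b by exact: (proj_minimalK iH mB mA).
have H1 := proj_pyth completeX catX y cB (proj_in completeX catX x cB).
have H2 := quadrilateral catX x y b (proj B x).
have H3 := dist_proj_const iH mA cB iB Ax Ay.
have H4 := proj_minimal_isometric iH mA mB Ax Ay.
rewrite yb in H1 H3 H4; rewrite (metric_sym b) in H1 H2.
rewrite (metric_sym (proj B x) x) in H2.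
by rewrite H4 H3 in H1 H2 *; lra.
Qed.

(** Completeness makes the image closed, uniqueness of geodesic points makes it convex, and an
    invariant subset of the image pulls back along s to one of A. *)
Lemma minimal_inv_image H A (s : X -> X) : minimal_inv H A -> isometric_on A s ->
  commutes_on A H s -> minimal_inv H (s @` A).
Proof.
move=> [[A0 clA cA] iA Amin] si sH; split.
- split; first by case: A0 => a Aa; exists (s a), a.
    move=> z Hz.
    have [||||p Hp] := @complete_family R X completeX R [set e | 0 < e]
        (fun e => [set y | A y /\ D z (s y) < e]).
    + by exists 1; rewrite /= ltr01.
    + by move=> e /= e0; have [_ [y Ay <-] zy] := Hz e e0; exists y.
    + move=> e e' /= e0 e'0; exists (Num.min e e'); first by rewrite /= lt_min e0.
      by move=> y [Ay]; rewrite lt_min => /andP[].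
    + move=> e e0; exists (e / 2); first by rewrite /= divr_gt0.
      move=> x y [Ax zx] [Ay zy]; rewrite -si//.
      have := metric_triangle (s x) z (s y); rewrite (metric_sym (s x) z); lra.
    have Ap : A p.
      by apply: clA => e e0; have [y [Ay _] py] := Hp 1 ltr01 e e0; exists y.
    exists p => //; apply/esym/mdist_positivity/eqP.
    rewrite eq_le mdist_ge0 andbT; apply/ler_addgt0Pl => e e0.
    have e2 : 0 < e / 2 by rewrite divr_gt0.
    have [y [Ay zy] py] := Hp (e / 2) e2 (e / 2) e2.
    have := metric_triangle z (s y) (s p); rewrite si// (metric_sym y p); lra.
  move=> t _ _ m [x Ax <-] [y Ay <-] tI xm.
  have [n xn] := between_exists catX x y tI; have An := cA _ _ _ _ Ax Ay tI xn.
  exists n => //; apply: (between_unique catX tI _ xm).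
  exact: (between_isometric si Ax Ay An xn).
- by move=> h _ Hh [x Ax <-]; exists (h x); [exact: iA|rewrite sH].
- move=> C [[c Cc] clC cC] iC CA.
  suff AC : A `<=` [set y | A y /\ C (s y)] by move=> _ [y /AC[_ ?] <-].
  apply: Amin => [||y []//]; last first.
    by move=> h y Hh [Ay Cy]; split; [exact: iA|rewrite sH//; exact: iC].
  split; first by have [y Ay yc] := CA c Cc; exists y; rewrite /= yc.
    move=> y Hy; have Ay : A y.
      by apply: clA => e e0; have [w [Aw _] yw] := Hy e e0; exists w.
    split=> //; apply: clC => e e0; have [w [Aw Cw] yw] := Hy e e0.
    by exists (s w) => //; rewrite si.
  move=> t x y m [Ax Cx] [Ay Cy] tI xm; have Am := cA _ _ _ _ Ax Ay tI xm.
  by split=> //; apply: cC Cx Cy tI (between_isometric si Ax Ay Am xm).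
Qed.

Lemma minimal_inv_eq H A B z : minimal_inv H A -> minimal_inv H B ->
  A z -> B z -> A = B.
Proof.
move=> [[_ clA cA] iA minA] [[_ clB cB] iB minB] Az Bz.
have cI : ccvx (A `&` B).
  split; first by exists z.
    move=> x Hx; split; [apply: clA|apply: clB] => e e0;
      by have [y [Ay By] xy] := Hx e e0; exists y.
  by move=> t x y m [Ax Bx] [Ay By] tI xm; split; [exact: cA xm|exact: cB xm].
have iI : inv_under H (A `&` B).
  by move=> h x Hh [Ax Bx]; split; [exact: iA|exact: iB].
apply/seteqP; split=> x.
  by move/(minA _ cI iI (@subIsetl _ _ _)) => [].
by move/(minB _ cI iI (@subIsetr _ _ _)) => [].
Qed.

(** * Tameness and the absence of holonomy *)

Definition commuting H K := forall h k, H h -> K k -> forall x, h (k x) = k (h x).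

(** The form in which non-evanescence enters. It is applied to the whole group with K empty, and to
    a factor with its cofactor. *)
Definition tame H K := forall x (T : set X),
  (forall h y, H h -> T y -> D (h y) y <= D (h x) x) ->
  (forall k y, K k -> T y -> D (k y) y <= D (k x) x) -> metric_bounded T.

Section Tame.
Variables H K : set (X -> X).
Hypotheses (iH : isometries H) (iK : isometries K) (cHK : commuting H K).
Hypothesis tHK : tame H K.

(* The displacement functions of tau, tau^2, tau^4, ... are constant on A and
   each is at least twice the preceding one, but the orbit of x under the
   centralizer is bounded by tameness. *)
Lemma centralizer_trivial A (tau : X -> X) x : minimal_inv H A ->
  (forall y, A y -> A (tau y)) -> isometric_on A tau -> commutes_on A H tau ->
  A x -> tau x = x.
Proof.
move=> mA tA ti tH Ax; have [[_ _ cA] iA _] := mA.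
pose cent (s : X -> X) :=
  [/\ forall y, A y -> A (s y), isometric_on A s & commutes_on A H s].
have [||M MP] := tHK (x := x) (T := [set s x | s in cent]).
- move=> h _ Hh [s [sA si sH] <-]; rewrite -sH// si//; exact: iA.
- move=> k _ Kk [s [sA si sH] <-].
  (* Since k commutes with H, its displacement is constant on A, which contains both x and [s x]. *)
  rewrite (@displacement_const H A k (s x) x)//; last exact: sA.
    by move=> y z _ _; exact: (iK Kk).1.
  by move=> h y Hh _; rewrite (cHK Hh Kk).
have idM : cent id by split.
(* The midpoints of x, [s x] and of [s x], [s (s x)] are [D (s x) x] apart by constancy, and at most
   half of [D (s (s x)) x] apart by comparison at the apex [s x]. *)
have doubling s : cent s -> 2 * D (s x) x <= D (s (s x)) x.
  move=> [sA si sH]; have hI : 0 <= (2^-1 : R) <= 1 by lra.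
  have [m xm] := between_exists catX x (s x) hI.
  have Am := cA _ _ _ _ Ax (sA _ Ax) hI xm.
  have smx := between_isometric si Ax (sA _ Ax) Am xm.
  have mx := between_sym xm; have hE : 1 - 2^-1 = 2^-1 :> R by lra.
  rewrite hE in mx; have := between_dist_common catX hI smx mx.
  rewrite (displacement_const iH mA si sH Am Ax); lra.
have pow n : forall s, cent s -> 2 ^+ n * D (s x) x <= M.
  elim: n => [|n IHn] s cs.
    by rewrite expr0 mul1r; apply: MP; [exists s|exists id].
  have css : cent (s \o s).
    have [sA si sH] := cs; split=> [y Ay|y z Ay Az|h y Hh Ay] /=.
    - exact: (sA _ (sA _ Ay)).
    - by rewrite !si//; exact: sA.
    - by rewrite sH// sH//; exact: sA.
  apply: le_trans (IHn _ css); rewrite exprSr -mulrA.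
  by rewrite ler_wpM2l ?exprn_ge0//; exact: doubling.
apply/mdist_positivity/eqP; rewrite eq_le mdist_ge0 andbT leNgt.
apply/negP => d0; set d := D _ _ in d0.
have := pow (Num.bound `|M / d|) tau (And3 tA ti tH).
rewrite -/d -ler_pdivlMr//; apply/negP; rewrite -ltNge.
apply: (le_lt_trans (ler_norm _)); apply: (lt_trans (archi_boundP (normr_ge0 _))).
by rewrite -natrX ltr_nat ltn_expl.
Qed.

(** The round trip from A through B and C back to A is an isometry of A commuting with H, so
    [centralizer_trivial] makes it the identity. *)
Lemma holonomy A B C x : minimal_inv H A -> minimal_inv H B -> minimal_inv H C ->
  A x -> proj C (proj B x) = proj C x.
Proof.
move=> mA mB mC Ax.
have [cA iA _] := mA; have [cB iB _] := mB; have [cC iC _] := mC.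
have pA y := proj_in completeX catX y cA; have pB y := proj_in completeX catX y cB.
have pC y := proj_in completeX catX y cC.
suff E : proj A (proj C (proj B x)) = x.
  by rewrite -[in RHS]E (proj_minimalK iH mC mA).
apply: (@centralizer_trivial A (fun y => proj A (proj C (proj B y)))) => //.
  move=> y z Ay Az; rewrite (proj_minimal_isometric iH mC mA)//.
  by rewrite (proj_minimal_isometric iH mB mC)// (proj_minimal_isometric iH mA mB).
move=> h y Hh Ay; rewrite (proj_equivariant y iH cB iB Hh).
by rewrite (proj_equivariant _ iH cC iC Hh) (proj_equivariant _ iH cA iA Hh).
Qed.

(* The projections of x to invariant subsets of C0 are displaced at most as
   much as x by the elements of H, and also by those of K since they lie in C0. *)
Lemma tame_minimal_exists Z x : ccvx Z -> inv_under H Z -> Z x ->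
  exists2 A, minimal_inv H A & A `<=` Z.
Proof.
move=> cZ iZ Zx; have [_ clZ cvZ] := cZ.
pose C0 : set X := [set y | Z y /\ forall k, K k -> D (k y) y <= D (k x) x].
have cC0 : ccvx C0.
  split; first by exists x.
    move=> y Hy; split.
      by apply: clZ => e e0; have [z [Zz _] yz] := Hy e e0; exists z.
    move=> k Kk; apply/ler_addgt0Pl => e e0.
    have [|z [_ /(_ k Kk) kz] yz] := Hy (e / 2); first by rewrite divr_gt0.
    have := (iK Kk).1 y z I I.
    have := metric_triangle (k y) (k z) y; have := metric_triangle (k z) z y.
    rewrite (metric_sym z y); lra.
  move=> t y z m [Zy ky] [Zz kz] tI ym; split; first exact: cvZ ym.
  move=> k Kk; have := ky k Kk; have := kz k Kk.
  have := between_dist catX tI (between_isometric (iK Kk).1 I I I ym) ym.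
  by case/andP: tI => t0 t1; nra.
have iC0 : inv_under H C0.
  move=> h y Hh [Zy ky]; split; first exact: iZ.
  by move=> k Kk; rewrite -(cHK Hh Kk) (iH Hh).1//; exact: ky.
have [||M MP] := tHK (x := x)
    (T := [set p | exists C, [/\ ccvx C, inv_under H C, C `<=` C0 & p = proj C x]]).
- move=> h _ Hh [C [cC iC _ ->]].
  rewrite -(proj_equivariant x iH cC iC Hh); exact: proj_nonexpansive.
- move=> k _ Kk [C [cC _ CC0 ->]].
  by have [_] := CC0 _ (proj_in completeX catX x cC); exact.
have [C cC iC CC0|A mA AC0] :=
  minimal_inv_exists (r := M) (x := x) completeX catX cC0 iC0.
  apply: MP; last by exists C.
  by exists C0; split=> //; rewrite (proj_id completeX catX cC0).
by exists A => // y /AC0[].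
Qed.

End Tame.

End MinimalSets.

(** Coordinates on Z as A times a transversal: f reads the A-part, on which only H acts, and q
    retracts onto the transversal, on which only K acts. Keeping q valued in Z allows several
    splittings to be composed. *)
Record splitting (R : realType) (X : metricType R) (H K : set (X -> X))
    (Z A : set X) (f q : X -> X) : Prop := Splitting {
  splitting_f_in : forall z, Z z -> A (f z) ;
  splitting_q_in : forall z, Z z -> Z (q z) ;
  splitting_dist : forall z w, Z z -> Z w ->
    mdist z w ^+ 2 = mdist (f z) (f w) ^+ 2 + mdist (q z) (q w) ^+ 2 ;
  splitting_f_between : forall t z w m, Z z -> Z w -> 0 <= t <= 1 ->
    between t z w m -> between t (f z) (f w) (f m) ;
  splitting_q_between : forall t z w m, Z z -> Z w -> 0 <= t <= 1 ->
    between t z w m -> between t (q z) (q w) (q m) ;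
  splitting_fH : forall h z, H h -> Z z -> f (h z) = h (f z) ;
  splitting_fK : forall k z, K k -> Z z -> f (k z) = f z ;
  splitting_qH : forall h z, H h -> Z z -> q (h z) = q z ;
  splitting_qK : forall k z, K k -> Z z -> q (k z) = k (q z) ;
  splitting_surj : forall a z, A a -> Z z ->
    exists2 z', Z z' & f z' = a /\ q z' = q z ;
  splitting_qq : forall z, Z z -> q (q z) = q z
}.

(** * Splitting off one factor *)

Section TwoFactors.
Variables (R : realType) (X : metricType R).
Hypotheses (completeX : complete_space X) (catX : CAT0 X).
Implicit Types (x y z m p : X) (t : R) (A B C Z : set X).
Variables H K : set (X -> X).
Hypotheses (iH : isometries H) (iK : isometries K) (cHK : commuting H K).
Hypothesis tHK : tame H K.

Local Notation D := (@mdist R X).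
Local Notation minH := (minimal_inv H).

Let pin A x : ccvx A -> A (proj A x).
Proof. exact: proj_in. Qed.

Let sqr_inj (a b : R) : 0 <= a -> 0 <= b -> a ^+ 2 = b ^+ 2 -> a = b.
Proof.
move=> a0 b0 ab; apply/eqP; rewrite eq_le.
by apply/andP; split; apply: sqr_le_le => //; rewrite ab.
Qed.

Lemma flat_strip B C t z w m : minH B -> minH C -> B z -> C w -> 0 <= t <= 1 ->
  between t z w m -> exists S, [/\ minH S, S m,
    forall Z, bconvex Z -> B `<=` Z -> C `<=` Z -> S `<=` Z,
    between t z (proj B w) (proj B m)
  & forall u, B u -> between t u (proj C u) (proj S u)].
Proof.
move=> mB mC Bz Cw tI zm; case/andP: (tI) => t0 t1.
have [cB iB _] := mB; have [cC iC _] := mC; have [_ _ cvB] := cB.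
pose s y := xget y [set p | between t y (proj C y) p].
have sP y : between t y (proj C y) (s y).
  by apply: (xgetPex y); have [p] := between_exists catX y (proj C y) tI; exists p.
have hC y v : B y -> B v -> D y (proj C y) = D v (proj C v).
  exact: (dist_proj_const completeX catX iH mB cC iC).
have projB y : B y -> proj B (s y) = y.
  move=> By; apply: (proj_eq_min completeX catX cB By) => c Bc.
  have [ys sy] := sP y.
  have := proj_le completeX catX c cC (pin y cC); rewrite (hC c y)//.
  have := metric_triangle c (s y) (proj C y); rewrite sy.
  rewrite (metric_sym (s y) y) ys (metric_sym c (s y)); lra.
have si : isometric_on B s.
  move=> y v By Bv; apply/eqP; rewrite eq_le; apply/andP; split.
    have := between_dist catX tI (sP y) (sP v).
    by rewrite (proj_minimal_isometric completeX catX iH mB mC)//; lra.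
  rewrite -{1}(projB y By) -{1}(projB v Bv); exact: proj_nonexpansive.
have sH : commutes_on B H s.
  move=> h y Hh By; apply: (between_unique catX tI (sP _)).
  rewrite (proj_equivariant completeX catX y iH cC iC Hh).
  exact: (between_isometric (iH Hh).1 I I I (sP y)).
have mS := minimal_inv_image completeX catX mB si sH; set S := s @` B in mS.
have Ss y : B y -> S (s y) by exists y.
set y1 := proj B w; have By1 : B y1 by exact: pin.
have [v zv] := between_exists catX z y1 tI; have Bv := cvB _ _ _ _ Bz By1 tI zv.
have Py1 : proj C y1 = w by exact: (proj_minimalK completeX catX iH mC mB).
have Pi := proj_minimal_isometric completeX catX iH mB mC.
have zw2 : D z w ^+ 2 = D z (proj C z) ^+ 2 + D z y1 ^+ 2.
  by rewrite (minimal_pythagoras completeX catX iH mB mC Bz Cw)// -(Pi z y1)// Py1.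
have vs : D v (s v) = t * D z (proj C z) by rewrite (sP v).1 (hC v z).
have sv : D (s v) (proj C v) = (1 - t) * D z (proj C z).
  by rewrite (sP v).2 (hC v z).
have Pvw : D (proj C v) w = (1 - t) * D z y1 by rewrite -zv.2 -(Pi v y1)// Py1.
(* [s v] has the distances to z and w that determine m. By [holonomy], projecting [s v] to C agrees
   with projecting v. *)
have msv : m = s v.
  apply: (between_unique catX tI zm); split; apply: sqr_inj.
  - exact: mdist_ge0.
  - by rewrite mulr_ge0// mdist_ge0.
  - rewrite metric_sym (minimal_pythagoras completeX catX iH mS mB (Ss v Bv) Bz).
    rewrite projB//.
    by rewrite (metric_sym (s v)) vs (metric_sym v) zv.1 !exprMn zw2; ring.
  - exact: mdist_ge0.
  - by rewrite mulr_ge0 ?mdist_ge0// subr_ge0.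
  - rewrite (minimal_pythagoras completeX catX iH mS mC (Ss v Bv) Cw)//.
    rewrite -(holonomy completeX catX iH iK cHK tHK mS mB mC (Ss v Bv)) projB//.
    by rewrite sv Pvw !exprMn zw2; ring.
exists S; split=> //.
- by rewrite msv; exact: Ss.
- move=> Z cvZ BZ CZ _ [y By <-]; apply: cvZ (BZ y By) (CZ _ _) tI (sP y).
  exact: pin.
- by rewrite msv projB.
- move=> u Bu; rewrite -[X in proj S X](projB u Bu).
  by rewrite (proj_minimalK completeX catX iH mS mB)//; exact: Ss.
Qed.

(* A point in the closure of the union determines, as a limit of projections,
   an equivariant isometric embedding of a fixed minimal set A. *)
Lemma union_minimal_closed Z A : mclosed Z -> minH A ->
  mclosed [set z | exists B, [/\ minH B, B `<=` Z & B z]].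
Proof.
move=> clZ mA z Hz; have [cA iA _] := mA.
have near e : 0 < e -> exists w B, [/\ minH B, B `<=` Z, B w & D z w < e].
  by move=> e0; have [w [B [mB BZ Bw]] zw] := Hz e e0; exists w, B.
(* By [holonomy] the two projections of y correspond, so their distance is the constant distance
   between B and B', at most [D w w']. *)
have close y w w' B B' : A y -> minH B -> minH B' -> B w -> B' w' ->
    D (proj B y) (proj B' y) <= D z w + D z w'.
  move=> Ay mB mB' Bw Bw'; have [cB iB _] := mB; have [cB' iB' _] := mB'.
  rewrite -(holonomy completeX catX iH iK cHK tHK mA mB mB' Ay).
  rewrite (dist_proj_const completeX catX iH mB cB' iB' (pin y cB) Bw)//.
  apply: le_trans (proj_le completeX catX w cB' Bw') _.
  by rewrite (metric_sym z w) metric_triangle.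
(* The limit of the projections of y as B approaches z, kept with its rate of convergence. *)
pose lim y p := forall w B, minH B -> B `<=` Z -> B w -> D p (proj B y) <= D z w.
have limP y : A y -> exists p, lim y p.
  move=> Ay.
  have [||||p Hp] := @complete_family R X completeX R [set e | 0 < e]
    (fun e => [set p | exists w B,
       [/\ minH B, B `<=` Z, B w, D z w < e & p = proj B y]]).
  - by exists 1; rewrite /= ltr01.
  - move=> e /= /near[w [B [mB BZ Bw zw]]].
    by exists (proj B y); exists w, B.
  - move=> e e' /= e0 e'0; exists (Num.min e e'); first by rewrite /= lt_min e0.
    move=> p [w [B [mB BZ Bw + ->]]]; rewrite lt_min => /andP[we we'].
    by split; exists w, B.
  - move=> e e0; exists (e / 2); first by rewrite /= divr_gt0.
    move=> _ _ [w [B [mB BZ Bw zw ->]]] [w' [B' [mB' BZ' Bw' zw' ->]]].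
    have := close _ _ _ _ _ Ay mB mB' Bw Bw'; lra.
  exists p => w B mB BZ Bw; apply/ler_addgt0Pl => e e0.
  have e2 : 0 < e / 2 by rewrite divr_gt0.
  have [_ [w' [B' [mB' BZ' Bw' zw' ->]]] py] := Hp (e / 2) e2 (e / 2) e2.
  have := metric_triangle p (proj B' y) (proj B y).
  have := close _ _ _ _ _ Ay mB' mB Bw' Bw; lra.
pose s y := xget y [set p | lim y p].
have sP y : A y -> lim y (s y) by move=> Ay; apply: (xgetPex y); exact: limP.
have small p p' c : 0 <= c -> (forall w B, minH B -> B `<=` Z -> B w ->
    D p p' <= c * D z w) -> p = p'.
  move=> c0 Hpp'; apply/mdist_positivity/eqP.
  rewrite eq_le mdist_ge0 andbT; apply/ler_addgt0Pl => e e0; rewrite addr0.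
  have c1 : 0 < c + 1 by rewrite ltr_wpDl.
  have [|w [B [mB BZ Bw zw]]] := near (e / (c + 1)); first by rewrite divr_gt0.
  apply: le_trans (Hpp' w B mB BZ Bw) _.
  by rewrite ltr_pdivlMr// in zw; have := mdist_ge0 z w; lra.
have si : isometric_on A s.
  move=> y v Ay Av; apply/eqP; rewrite eq_le.
  apply/andP; split; apply/ler_addgt0Pl => e e0;
    have [|w [B [mB BZ Bw zw]]] := near (e / 2); rewrite ?divr_gt0//;
    have := sP y Ay w B mB BZ Bw; have := sP v Av w B mB BZ Bw;
    have := proj_minimal_isometric completeX catX iH mA mB Ay Av.
    have := metric_triangle (s y) (proj B y) (s v).
    have := metric_triangle (proj B y) (proj B v) (s v).
    rewrite (metric_sym (proj B v) (s v)); lra.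
  have := metric_triangle (proj B y) (s y) (proj B v).
  have := metric_triangle (s y) (s v) (proj B v).
  rewrite (metric_sym (proj B y) (s y)); lra.
have sH : commutes_on A H s.
  move=> h y Hh Ay; apply: (@small _ _ 2) => // w B mB BZ Bw.
  have [cB iB _] := mB.
  have := sP (h y) (iA _ _ Hh Ay) w B mB BZ Bw; have := sP y Ay w B mB BZ Bw.
  rewrite (proj_equivariant completeX catX y iH cB iB Hh).
  rewrite -((iH Hh).1 _ _ I I) metric_sym.
  have := metric_triangle (s (h y)) (h (proj B y)) (h (s y)); lra.
exists (s @` A); split; first exact: minimal_inv_image.
  move=> _ [y Ay <-]; apply: clZ => e e0.
  have [w [B [mB BZ Bw zw]]] := near e e0; have [cB _ _] := mB.
  exists (proj B y); first by apply: BZ; exact: pin.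
  by apply: le_lt_trans zw; exact: sP.
(* Via w and [proj B (proj A z)], z is within [3 * D z w] of the image of this point. *)
exists (proj A z); first exact: pin.
apply/esym/(@small _ _ 3) => // w B mB BZ Bw; have [cB iB _] := mB.
have := sP _ (pin z cA) w B mB BZ Bw.
have := proj_nonexpansive completeX catX (proj A w) (proj A z) cB.
rewrite (proj_minimalK completeX catX iH mB mA Bw).
have := proj_nonexpansive completeX catX w z cA.
have := metric_triangle z w (s (proj A z)).
have := metric_triangle w (proj B (proj A z)) (s (proj A z)).
rewrite (metric_sym w z) (metric_sym (proj B _)); lra.
Qed.

Variable Z : set X.
Hypotheses (cZ : ccvx Z) (iHZ : inv_under H Z) (iKZ : inv_under K Z).
Hypothesis minZ : forall C, ccvx C -> inv_under H C -> inv_under K C ->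
  C `<=` Z -> Z `<=` C.

Lemma minimal_image_isometry k B : K k -> minH B -> minH (k @` B).
Proof.
move=> Kk mB; apply: minimal_inv_image => //.
  by move=> y v _ _; exact: (iK Kk).1.
by move=> h y Hh _; rewrite (cHK Hh Kk).
Qed.

Lemma minimal_cover z : Z z -> exists B, [/\ minH B, B `<=` Z & B z].
Proof.
have [[z0 Zz0] clZ cvZ] := cZ.
have [A mA AZ] := tame_minimal_exists completeX catX iH iK cHK tHK cZ iHZ Zz0.
pose M := [set z | exists B, [/\ minH B, B `<=` Z & B z]].
suff : Z `<=` M by exact.
apply: minZ; last by move=> y [B [_ BZ By]]; exact: BZ.
- split; first by have [[[a Aa] _ _] _ _] := mA; exists a, A.
    exact: union_minimal_closed mA.
  move=> t x y m [B [mB BZ Bx]] [C [mC CZ Cy]] tI xm.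
  have [S [mS Sm SZ _ _]] := flat_strip mB mC Bx Cy tI xm.
  by exists S; split=> //; exact: SZ.
- by move=> h x Hh [B [mB BZ Bx]]; exists B; split=> //; case: mB => _ iB _; exact: iB.
- move=> k x Kk [B [mB BZ Bx]]; exists (k @` B); split.
  + exact: minimal_image_isometry.
  + by move=> _ [b Bb <-]; apply: iKZ => //; exact: BZ.
  + by exists x.
Qed.

(** A base point u of A marks the transversal: f projects to A, and q sends z to the projection of u
    to the minimal set through z. [minimal_pythagoras] and [holonomy] give the metric splitting. *)
Lemma two_factor_splitting : exists A f q,
  [/\ minH A, A `<=` Z & splitting H K Z A f q].
Proof.
have [[z0 Zz0] clZ cvZ] := cZ.
have [A mA AZ] := tame_minimal_exists completeX catX iH iK cHK tHK cZ iHZ Zz0.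
have [cA iA _] := mA; have [[u Au] _ _] := cA.
pose block z := xget set0 [set B | [/\ minH B, B `<=` Z & B z]].
have blockP z : Z z -> [/\ minH (block z), block z `<=` Z & block z z].
  by move=> /minimal_cover; exact: (xgetPex set0).
pose f z := proj A z; pose q z := proj (block z) u.
have hol := holonomy completeX catX iH iK cHK tHK.
have blockE z B : minH B -> B `<=` Z -> B z -> block z = B.
  move=> mB BZ Bz; have [mb _ bz] := blockP z (BZ z Bz).
  exact: (minimal_inv_eq mb mB bz Bz).
have qE z B : minH B -> B `<=` Z -> B z -> q z = proj B u.
  by move=> mB BZ Bz; rewrite /q (blockE z B).
have mK k B : K k -> minH B -> B `<=` Z -> minH (k @` B) /\ k @` B `<=` Z.
  move=> Kk mB BZ; split; first exact: minimal_image_isometry.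
  by move=> _ [b Bb <-]; apply: iKZ => //; exact: BZ.
(* The return map of B to itself through k B is trivial. *)
have projk k B y : K k -> minH B -> B y -> proj B (k y) = y.
  move=> Kk mB By; have mkB := minimal_image_isometry Kk mB; have [cB iB _] := mB.
  apply: (centralizer_trivial catX iH iK cHK tHK mB
    (tau := fun y => proj B (k y))) => //.
  - by move=> v _; exact: pin.
  - move=> v w Bv Bw.
    rewrite (proj_minimal_isometric completeX catX iH mkB mB);
      [|by exists v|by exists w].
    exact: (iK Kk).1.
  - move=> h v Hh Bv; rewrite -(cHK Hh Kk).
    exact: (proj_equivariant completeX catX (k v) iH cB iB Hh).
have ccv B : minH B -> ccvx B by case.
exists A, f, q; split=> //; split.
- by move=> z _; exact: pin.
- by move=> z /blockP[mB BZ _]; apply: BZ; apply: pin; exact: ccv.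
- move=> z w /blockP[mB BZ Bz] /blockP[mC CZ Cw].
  have [cC iC _] := mC; have cB := ccv _ mB.
  rewrite (minimal_pythagoras completeX catX iH mB mC Bz Cw) addrC.
  rewrite -(proj_minimal_isometric completeX catX iH mC mA (pin z cC) Cw).
  rewrite (hol _ _ _ _ mB mC mA Bz) -/(f z) -/(f w); congr (_ + _ ^+ 2).
  rewrite (dist_proj_const completeX catX iH mB cC iC Bz (pin u cB)).
  by rewrite (hol _ _ _ _ mA mB mC Au).
- move=> t z w m /blockP[mB BZ Bz] /blockP[mC CZ Cw] tI zm.
  have [S [mS Sm _ zmB _]] := flat_strip mB mC Bz Cw tI zm.
  have := between_isometric (proj_minimal_isometric completeX catX iH mB mA)
    Bz (pin w (ccv _ mB)) (pin m (ccv _ mB)) zmB.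
  by rewrite (hol _ _ _ _ mC mB mA Cw) (hol _ _ _ _ mS mB mA Sm).
- move=> t z w m /blockP[mB BZ Bz] /blockP[mC CZ Cw] tI zm.
  have [S [mS Sm SZ _ uS]] := flat_strip mB mC Bz Cw tI zm.
  rewrite (qE m S mS (SZ _ cvZ BZ CZ) Sm); have := uS _ (pin u (ccv _ mB)).
  by rewrite (hol _ _ _ _ mA mB mC Au) (hol _ _ _ _ mA mB mS Au).
- by move=> h z Hh _; exact: (proj_equivariant completeX catX z iH cA iA Hh).
- move=> k z Kk /blockP[mB BZ Bz]; have [mkB kBZ] := mK _ _ Kk mB BZ.
  have kz : (k @` block z) (k z) by exists z.
  by rewrite /f -(hol _ _ _ _ mkB mB mA kz) (projk _ _ _ Kk mB Bz).
- move=> h z Hh /blockP[mB BZ Bz]; apply: qE => //.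
  by case: mB => _ iB _; exact: iB.
- move=> k z Kk /blockP[mB BZ Bz]; have [mkB kBZ] := mK _ _ Kk mB BZ.
  have kz : (k @` block z) (k z) by exists z.
  rewrite (qE _ _ mkB kBZ kz).
  have mkA := minimal_image_isometry Kk mA.
  have ku : (k @` A) (k u) by exists u.
  (* As u is the projection of [k u] to A, [holonomy] lets [k u] replace u when projecting to the
     image of the block under k. *)
  rewrite -[X in proj _ X](projk k A u Kk mA Au) (hol _ _ _ _ mkA mA mkB ku).
  apply: (proj_isometry_image completeX catX _ (ccv _ mB) (ccv _ mkB)).
  + by move=> x y; exact: (iK Kk).1.
  + by move=> c Bc; exists c.
  + by move=> _ [c Bc <-]; exists c.
- move=> a z Aa /blockP[mB BZ Bz]; have Ba := pin a (ccv _ mB).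
  exists (proj (block z) a); first exact: BZ.
  by split; [exact: (proj_minimalK completeX catX iH mA mB)|exact: qE].
- move=> z /blockP[mB BZ Bz]; rewrite (qE (q z) _ mB BZ)//.
  exact: pin (ccv _ mB).
Qed.

End TwoFactors.

(** * The canonical minimal set as a circumcentre *)

Section Center.
Variables (R : realType).

(** In the space of minimal sets, a ball of radius s about z contains everything; the infimum of
    such s over all z is the circumradius. *)
Definition reaches_minimal (X : metricType R) (H : set (X -> X)) z s :=
  forall B, minimal_inv H B -> exists2 b, B b & mdist z b <= s.

(* The minimal sets form a bounded metric space under the distance between
   sets; this is its circumcentre, as a union of minimal sets. *)
Definition center (X : metricType R) (H : set (X -> X)) : set X :=
  [set z | exists A, [/\ minimal_inv H A, A z
    & forall z' s, reaches_minimal H z' s -> reaches_minimal H z s]].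

Definition conj_isometry (X Y : metricType R) (H : set (X -> X))
    (H' : set (Y -> Y)) (phi : X -> Y) (psi : Y -> X) :=
  [/\ cancel phi psi, cancel psi phi, isometric_on setT phi,
      forall h, H h -> exists2 h', H' h' & forall x, phi (h x) = h' (phi x)
    & forall h', H' h' -> exists2 h, H h & forall x, phi (h x) = h' (phi x)].

Lemma conj_isometry_sym (X Y : metricType R) H H' (phi : X -> Y) psi :
  conj_isometry H H' phi psi -> conj_isometry H' H psi phi.
Proof.
move=> [phiK psiK phii HH' H'H]; split=> //.
- by move=> x y _ _; rewrite -phii// !psiK.
- by move=> h' /H'H[h Hh hh']; exists h => // y; rewrite -[y in LHS]psiK -hh' phiK.
- by move=> h /HH'[h' Hh' hh']; exists h' => // y; rewrite -[y in LHS]psiK -hh' phiK.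
Qed.

Lemma ccvx_transport (X Y : metricType R) H H' (phi : X -> Y) psi A :
  conj_isometry H H' phi psi -> ccvx A -> ccvx (psi @^-1` A).
Proof.
move=> cphi; have [psiK phiK psii _ _] := conj_isometry_sym cphi.
move=> [[a Aa] clA cA]; split; first by exists (phi a); rewrite /= phiK.
  move=> y Hy; apply: clA => e e0; have [z Az yz] := Hy e e0.
  by exists (psi z) => //; rewrite psii.
move=> t x y m Ax Ay tI xm; apply: cA Ax Ay tI _.
exact: (between_isometric psii I I I xm).
Qed.

Lemma inv_transport (X Y : metricType R) H H' (phi : X -> Y) psi A :
  conj_isometry H H' phi psi -> inv_under H A -> inv_under H' (psi @^-1` A).
Proof.
move=> cphi; have [psiK phiK psii H'H _] := conj_isometry_sym cphi.
by move=> iA h' y /H'H[h Hh hh'] Ay; rewrite /= hh'; exact: iA.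
Qed.

Lemma minimal_transport (X Y : metricType R) H H' (phi : X -> Y) psi A :
  conj_isometry H H' phi psi -> minimal_inv H A -> minimal_inv H' (psi @^-1` A).
Proof.
move=> cphi [cA iA minA]; have cpsi := conj_isometry_sym cphi.
have [psiK phiK _ _ _] := cpsi; split.
- exact: ccvx_transport cphi cA.
- exact: inv_transport cphi iA.
- move=> B cB iB BA y Ay; rewrite -[y]psiK.
  apply: (minA _ (ccvx_transport cpsi cB) (inv_transport cpsi iB) _ _ Ay).
  by move=> x /BA; rewrite /= phiK.
Qed.

Lemma reaches_minimal_transport (X Y : metricType R) H H' (phi : X -> Y) psi z s :
  conj_isometry H H' phi psi -> reaches_minimal H z s ->
  reaches_minimal H' (phi z) s.
Proof.
move=> cphi Hz B /(minimal_transport (conj_isometry_sym cphi))/Hz[b Bb zb].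
by exists (phi b) => //; case: cphi => _ _ ->.
Qed.

Lemma center_transport (X Y : metricType R) H H' (phi : X -> Y) psi :
  conj_isometry H H' phi psi -> center H' = phi @` center H.
Proof.
(* Stated for arbitrary spaces so as to apply to the inverse conjugation too. *)
have sub (X1 Y1 : metricType R) H1 H1' (phi1 : X1 -> Y1) psi1 z :
    conj_isometry H1 H1' phi1 psi1 -> center H1 z -> center H1' (phi1 z).
  move=> cphi [A [mA Az Hz]]; have [phiK psiK _ _ _] := cphi.
  exists (psi1 @^-1` A); split.
  - exact: minimal_transport cphi mA.
  - by rewrite /= phiK.
  - move=> z' s /(reaches_minimal_transport (conj_isometry_sym cphi))/Hz.
    exact: (reaches_minimal_transport cphi).
move=> cphi; apply/seteqP; split=> [y|_ [x Hx <-]]; last exact: sub cphi Hx.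
have [_ psiK _ _ _] := cphi.
by move/(sub _ _ _ _ _ _ _ (conj_isometry_sym cphi)); exists (psi y).
Qed.

Section Existence.
Variable X : metricType R.
Hypotheses (completeX : complete_space X) (catX : CAT0 X).
Variables (H : set (X -> X)).
Hypotheses (iH : isometries H) (tH : tame H set0) (X0 : [set: X] !=set0).
Implicit Types (x y z m p : X) (t s : R) (A B C Z : set X).

Local Notation D := (@mdist R X).
Local Notation minH := (minimal_inv H).
Local Notation reach := (reaches_minimal H).

Let i0 : isometries (@set0 (X -> X)). Proof. by []. Qed.
Let c0 : commuting H set0. Proof. by []. Qed.

Let reachP z s : reach z s <-> forall B, minH B -> D z (proj B z) <= s.
Proof.
split=> Hz B mB; have [cB _ _] := mB; last first.
  by exists (proj B z); [exact: proj_in|exact: Hz].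
by have [b Bb] := Hz B mB; apply: le_trans; exact: proj_le.
Qed.

Let reach_closed z s : (forall e, 0 < e -> reach z (s + e)) -> reach z s.
Proof.
move=> Hz; apply/reachP => B mB; apply/ler_addgt0Pl => e /Hz/reachP/(_ B mB).
by rewrite addrC.
Qed.

Let reach_le z s s' : s <= s' -> reach z s -> reach z s'.
Proof. by move=> ss' /reachP Hz; apply/reachP => B /Hz/le_trans; apply. Qed.

Let reach_near z w s : reach z s -> reach w (s + D w z).
Proof.
move=> /reachP Hz; apply/reachP => B mB; have [cB _ _] := mB.
have := proj_le completeX catX w cB (proj_in completeX catX z cB).
have := metric_triangle w z (proj B z); have := Hz B mB; lra.
Qed.

Let reach_sublevel z s : reach z s -> ccvx (reach^~ s) /\ inv_under H (reach^~ s).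
Proof.
move=> Hz; split; first (split; first by exists z).
- move=> y Hy; apply: reach_closed => e e0; have [w Hw yw] := Hy e e0.
  by apply: reach_le (reach_near y Hw); rewrite lerD2l ltW.
- move=> t x y m /reachP Hx /reachP Hy tI xm; apply/reachP => B mB.
  have [cB _ _] := mB.
  apply: le_trans (dist_proj_convex completeX catX cB tI xm) _.
  by case/andP: tI => t0 t1; have := Hx B mB; have := Hy B mB; nra.
- move=> h x Hh /reachP Hx; apply/reachP => B mB; have [cB iB _] := mB.
  rewrite (proj_equivariant completeX catX x iH cB iB Hh) (iH Hh).1//.
  exact: Hx.
Qed.

Let reach_const A z w s : minH A -> A z -> A w -> reach z s -> reach w s.
Proof.
move=> mA Az Aw /reachP Hz; apply/reachP => B mB; have [cB iB _] := mB.
by rewrite (dist_proj_const completeX catX iH mA cB iB Aw Az); exact: Hz.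
Qed.

Let exists_minimal z s : reach z s -> exists2 A, minH A & A `<=` reach^~ s.
Proof.
move=> Hz; have [cS iS] := reach_sublevel Hz.
exact: (tame_minimal_exists completeX catX iH i0 c0 tH cS iS Hz).
Qed.

Let hol := holonomy completeX catX iH i0 c0 tH.

(** The radii have a finite infimum [rho], almost optimal minimal sets are close by [circ], their
    limit attains [rho], and [circ] at radius [rho] shows that only one minimal set does. *)
Lemma center_minimal : minH (center H).
Proof.
have [x Xx] := X0.
have cT : ccvx [set: X] by split.
have [A0 mA0 _] : exists2 A, minH A & A `<=` setT.
  exact: (tame_minimal_exists completeX catX iH i0 c0 tH cT _ Xx).
have [cA0 iA0 _] := mA0; have [[x0 Ax0] _ _] := cA0.
(* Projections of x0 to minimal sets are displaced no more than x0, so tameness bounds them and some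
   finite radius exists. *)
have [|//|M MP] := tH (x := x0) (T := [set p | exists2 B, minH B & p = proj B x0]).
  move=> h _ Hh [B mB ->]; have [cB iB _] := mB.
  rewrite -(proj_equivariant completeX catX x0 iH cB iB Hh).
  exact: proj_nonexpansive.
have reachM : reach x0 M.
  apply/reachP => B mB; apply: MP; last by exists B.
  by exists A0; rewrite // (proj_id completeX catX cA0).
pose E := [set s | exists z, reach z s].
have lbE : lbound E 0.
  by move=> s [z /(_ A0 mA0)[b _]]; apply: le_trans; exact: mdist_ge0.
have Einf : has_inf E by split; [exists M, x0 | exists 0].
pose rho := inf E.
have rho0 : 0 <= rho by apply: lb_le_inf => //; case: Einf.
have rhoE z s : reach z s -> rho <= s.
  by move=> zs; apply: ge_inf; [case: Einf|exists z].
(* The midpoint of z and its projection to A' is closer to every minimal set,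
   because both have the same projection to it. *)
have circ A A' z w s : minH A -> minH A' -> A z -> A' w -> reach z s ->
    reach w s -> D z (proj A' z) ^+ 2 <= 4 * (s ^+ 2 - rho ^+ 2).
  move=> mA mA' Az Aw zs ws; have [cA' _ _] := mA'.
  have w0s := reach_const mA' Aw (proj_in completeX catX z cA') ws.
  have hI : 0 <= (2^-1 : R) <= 1 by lra.
  have [m zm] := between_exists catX z (proj A' z) hI.
  set a := D z (proj A' z).
  have mid B : minH B -> D m (proj B m) ^+ 2 <= s ^+ 2 - a ^+ 2 / 4.
    move=> mB; have [cB _ _] := mB.
    have Bb := proj_in completeX catX z cB.
    apply: le_trans (le_le_sqr (mdist_ge0 _ _) (proj_le completeX catX m cB Bb)) _.
    have := cat0_ineq catX (proj B z) hI zm; rewrite (metric_sym (proj B z) m).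
    rewrite (metric_sym _ z) (metric_sym _ (proj A' z)) -/a.
    move/reachP: zs => /(_ B mB)/(le_le_sqr (mdist_ge0 _ _)).
    move/reachP: w0s => /(_ B mB); rewrite (hol mA mA' mB Az).
    move/(le_le_sqr (mdist_ge0 _ _)); lra.
  have r0 : 0 <= s ^+ 2 - a ^+ 2 / 4 by apply: le_trans (mid A0 mA0); exact: sqr_ge0.
  have : reach m (Num.sqrt (s ^+ 2 - a ^+ 2 / 4)).
    apply/reachP => B /mid mB; apply: sqr_le_le (sqrtr_ge0 _) _.
    by rewrite sqr_sqrtr.
  by move/rhoE/(le_le_sqr rho0); rewrite sqr_sqrtr//; lra.
(* Each candidate set is represented by the projection of x0 to it, so that by [holonomy] the
   representatives project to one another and [circ] bounds their distance. *)
have [||||p Hp] := @complete_family R X completeX R [set e | 0 < e]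
    (fun e => [set p | exists A, [/\ minH A, p = proj A x0 & reach p (rho + e)]]).
- by exists 1; rewrite /= ltr01.
- move=> e /= e0; have [s [z zs] se] := inf_adherent e0 Einf.
  have [A mA As] := exists_minimal zs; exists (proj A x0), A; split=> //.
  apply: reach_le (ltW se) (As _ _).
  by apply: (proj_in completeX catX); case: mA.
- move=> e e' /= e0 e'0; exists (Num.min e e'); first by rewrite /= lt_min e0.
  move=> p [A [mA pE pe]]; split; exists A; split=> //; apply: reach_le pe.
    by rewrite lerD2l ge_min lexx.
  by rewrite lerD2l ge_min lexx orbT.
- move=> r r0.
  have e_gt0 : 0 < Num.min 1 (r ^+ 2 / (4 * (2 * rho + 2))).
    by rewrite lt_min ltr01 divr_gt0// ?exprn_gt0//; lra.
  set e := Num.min _ _ in e_gt0 *.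
  have e1 : e <= 1 by rewrite ge_min lexx.
  have er : e * (4 * (2 * rho + 2)) <= r ^+ 2.
    by rewrite -ler_pdivlMr ?ge_min ?lexx ?orbT//; lra.
  exists e => // p p' [A [mA pE pe]] [A' [mA' p'E p'e]].
  have Ap : A p by rewrite pE; apply: (proj_in completeX catX); case: mA.
  have Ap' : A' p' by rewrite p'E; apply: (proj_in completeX catX); case: mA'.
  have := circ _ _ _ _ _ mA mA' Ap Ap' pe p'e.
  rewrite [X in proj A' X]pE (hol mA0 mA mA' Ax0) -p'E => H2.
  rewrite -ltr_sqr ?nnegrE ?mdist_ge0 ?(ltW r0)//.
  apply: (le_lt_trans H2); apply: lt_le_trans er.
  have : e * e <= e * 1 by rewrite ler_pM2l.
  lra.
have prho : reach p rho.
  apply: reach_closed => e e0; have e2 : 0 < e / 2 by rewrite divr_gt0.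
  have [q [A [_ _ qe]] pq] := Hp (e / 2) e2 (e / 2) e2.
  by apply: reach_le (reach_near p qe); lra.
have [C mC Crho] := exists_minimal prho.
suff -> : center H = C by [].
apply/seteqP; split=> [z [A [mA Az Hz]]|z Cz]; last first.
  exists C; split=> // z' s /rhoE rs.
  by apply: reach_le rs _; exact: Crho.
have [cC _ _] := mC; have Cq := proj_in completeX catX z cC.
have := circ _ _ _ _ _ mA mC Az Cq (Hz _ _ prho) (Crho _ Cq).
rewrite subrr mulr0 => H2; suff -> : z = proj C z by [].
by apply/mdist_positivity/eqP; rewrite -sqrf_eq0 eq_le H2 sqr_ge0.
Qed.

End Existence.
End Center.

(** * Subsets with the restricted metric *)

Section Submetric.
Variables (R : realType) (X : metricType R) (A : set X).

Definition submetric : Type := set_type A.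
HB.instance Definition _ := Choice.on submetric.

Let dist (x y : submetric) : R := mdist (val x) (val y).

Let dist_positivity x y : dist x y = 0 -> x = y.
Proof. by move=> xy; apply: val_inj; exact: mdist_positivity. Qed.

HB.instance Definition _ := isMetric.Build R submetric
  (fun x => mdistxx (val x) : dist x x = 0) dist_positivity
  (fun x y => metric_sym (val x) (val y) : dist x y = dist y x)
  (fun y x z => metric_triangle (val x) (val y) (val z) :
    dist x z <= dist x y + dist y z).

End Submetric.

(** * A product group and the isometries of its factors *)

Section ProductAction.
Variables (R : realType) (n : nat) (G : 'I_n -> topGroupType) (X : metricType R).
Variable a : isometric_action (prod_topology G) X.
Implicit Types (x y z m : X) (t : R) (i j : 'I_n) (g : prod_topology G).

Local Notation D := (@mdist R X).
Local Notation one := (1%g : prod_topology G).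

Definition single i (u : G i) : prod_topology G := dfwith one i u.
Definition remove i g : prod_topology G := dfwith g i (1%g : G i).

Definition factor i : set (X -> X) := [set a (single u) | u in [set: G i]].
Definition cofactor i : set (X -> X) := [set a g | g in [set g | g i = 1%g]].

Let mulgE g g' i : (g * g')%g i = (g i * g' i)%g. Proof. by []. Qed.

Lemma remove_id i g : remove i g i = 1%g.
Proof. exact: dfwithin. Qed.

Lemma remove_out i j g : i != j -> remove i g j = g j.
Proof. exact: dfwithout. Qed.

Lemma single_remove i g : g = (single (g i) * remove i g)%g.
Proof.
apply: functional_extensionality_dep => j; rewrite mulgE /single /remove.
have [<-|ij] := eqVneq i j; first by rewrite !dfwithin mulg1.
by rewrite !dfwithout// mul1g.
Qed.

Lemma remove_single i g : g = (remove i g * single (g i))%g.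
Proof.
apply: functional_extensionality_dep => j; rewrite mulgE /single /remove.
have [<-|ij] := eqVneq i j; first by rewrite !dfwithin mul1g.
by rewrite !dfwithout// mulg1.
Qed.

Lemma single_commute i (u : G i) g : g i = 1%g ->
  (single u * g = g * single u)%g.
Proof.
move=> gi; apply: functional_extensionality_dep => j; rewrite !mulgE /single.
have [<-|ij] := eqVneq i j; first by rewrite !dfwithin gi mulg1 mul1g.
by rewrite !dfwithout// mulg1 mul1g.
Qed.

Lemma singleM i (u v : G i) : single (u * v)%g = (single u * single v)%g.
Proof.
apply: functional_extensionality_dep => j; rewrite !mulgE /single.
have [<-|ij] := eqVneq i j; first by rewrite !dfwithin.
by rewrite !dfwithout// mulg1.
Qed.

Lemma single1 i : single (1%g : G i) = 1%g.
Proof.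
apply: functional_extensionality_dep => j; rewrite /single.
by have [<-|ij] := eqVneq i j; rewrite ?dfwithin ?dfwithout.
Qed.

Let iso_act (S : set (X -> X)) (P : set (prod_topology G)) :
  S `<=` [set a g | g in P] -> [set a g | g in P] `<=` S ->
  (forall g, P g -> P g^-1%g) -> isometries S.
Proof.
move=> SP PS PV h /SP[g Pg <-]; split; first by move=> x y _ _; exact: act_isometry.
exists (a g^-1%g); first by apply: PS; exists g^-1%g => //; exact: PV.
by split=> x; rewrite -actM ?mulVg ?mulgV act1.
Qed.

Lemma isometries_act : isometries (range a).
Proof. by apply: (@iso_act _ setT). Qed.

Lemma isometries_factor i : isometries (factor i).
Proof.
apply: (@iso_act _ (range (@single i))).
- by move=> _ [u _ <-]; exists (single u) => //; exists u.
- by move=> _ [_ [u _ <-] <-]; exists u.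
- move=> _ [u _ <-]; exists u^-1%g => //.
  by apply: (mulgI (single u)); rewrite mulgV -singleM mulgV single1.
Qed.

Lemma isometries_cofactor i : isometries (cofactor i).
Proof.
apply: (@iso_act _ [set g | g i = 1%g]) => //= g gi.
have : (g * g^-1)%g i = one i by rewrite mulgV.
by rewrite mulgE gi mul1g.
Qed.

Lemma commuting_factor i : commuting (factor i) (cofactor i).
Proof.
by move=> _ _ [u _ <-] [g gi <-] x; rewrite -!actM single_commute.
Qed.

Lemma remove_continuous i : continuous (remove i).
Proof.
apply: prod_continuous => j; have [<-|ij] := eqVneq i j.
  have -> : (fun g => remove i g i) = (fun=> 1%g).
    by apply/funext => g; exact: remove_id.
  exact: cst_continuous.
have -> : (fun g => remove i g j) = (fun g => g j).
  by apply/funext => g; exact: remove_out.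
exact: prod_proj_continuous.
Qed.

Lemma single_continuous i : continuous (fun g => single (g i)).
Proof.
move=> g; apply: (@continuous_comp _ _ _ (fun g => g i) (@single i)).
  exact: prod_proj_continuous.
exact: dfwith_continuous.
Qed.

End ProductAction.

(** * Boundedness from non-evanescence *)

Section Evanescence.
Variables (R : realType) (X : metricType R).

Lemma mdist_continuous (x : X) : continuous (fun y => mdist y x : R).
Proof.
move=> y; apply/cvgrPdist_lt => e e0.
apply: filterS (nbhsx_ballx y e e0) => z; rewrite ballEmdist /=.
apply: le_lt_trans; rewrite ler_norml.
have := metric_triangle y z x; have := metric_triangle z y x.
rewrite (metric_sym z y); lra.
Qed.

Lemma displacement_continuous (G : topGroupType) (a : isometric_action G X) x :
  continuous_action a -> continuous (fun g => mdist (a g x) x : R).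
Proof.
move=> ca g; apply: (@continuous_comp _ _ _ (fun g => a g x)
  (fun y => mdist y x : R)); last exact: mdist_continuous.
apply: (@continuous_comp _ _ _ (fun g => (g, x)) (fun p => a p.1 p.2)).
  by apply: cvg_pair => //=; exact: cvg_cst.
exact: ca.
Qed.

(** A continuous F is bounded on compact sets, so an unbounded T would witness evanescence. *)
Lemma not_evanescent_bounded (G : topGroupType) (a : isometric_action G X)
    (T : set X) (F : G -> R) : ~ evanescent a -> continuous F ->
  (forall g y, T y -> mdist (a g y) y <= F g) -> metric_bounded T.
Proof.
move=> nea cF TF; apply: contrapT => nT; apply: nea; exists T; split=> // Q cQ.
have /compact_bounded/pinfty_ex_gt0[M M0 FM] : compact (F @` Q).
  by apply: continuous_compact => //; exact: continuous_subspaceT.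
exists M; split; first exact: num_real.
move=> M' MM' _ [g Qg [y Ty <-]] /=; rewrite ger0_norm ?mdist_ge0//.
apply: le_trans (TF g y Ty) _; apply: le_trans (ltW MM').
by apply: le_trans (ler_norm _) (FM _ _); exists g.
Qed.

End Evanescence.

(** * Simultaneous splitting along all factors *)

Section Splitting.
Variables (R : realType) (n : nat) (G : 'I_n -> topGroupType) (X : metricType R).
Variable a : isometric_action (prod_topology G) X.
Hypotheses (completeX : complete_space X) (catX : CAT0 X).
Hypotheses (contA : continuous_action a) (nea : ~ evanescent a).
Implicit Types (x y z m : X) (t : R) (i j : 'I_n) (g : prod_topology G).

Local Notation D := (@mdist R X).

Lemma tame_act : tame (range a) set0.
Proof.
move=> x T Tx _; apply: (@not_evanescent_bounded _ _ _ a T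
  (fun g => D (a g x) x) nea); first exact: displacement_continuous.
by move=> g y Ty; apply: (Tx (a g) y) => //; exists g.
Qed.

(** Writing g as its i-th part times the rest bounds its displacement on T by the sum of the
    displacements of x by the two parts, which is continuous in g. *)
Lemma tame_factor i : tame (factor a i) (cofactor a i).
Proof.
move=> x T Hx Kx.
have cD := @displacement_continuous _ _ _ a x contA.
have c1 : continuous (fun g => D (a (single (g i)) x) x : R).
  move=> g; exact: (@continuous_comp _ _ _
    (fun g : prod_topology G => single (g i)) (fun g => D (a g x) x : R) g
    (@single_continuous n G i g) (cD _)).
have c2 : continuous (fun g => D (a (remove i g) x) x : R).
  move=> g; exact: (@continuous_comp _ _ _ (@remove n G i)
    (fun g => D (a g x) x : R) g (@remove_continuous n G i g) (cD _)).
apply: (@not_evanescent_bounded _ _ _ a T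
  (fun g => D (a (single (g i)) x) x + D (a (remove i g) x) x) nea).
  by move=> g; exact: (cvgD (c1 g) (c2 g)).
move=> g y Ty.
have H1 : D (a (single (g i)) y) y <= D (a (single (g i)) x) x.
  by apply: Hx Ty; exists (g i).
have H2 : D (a (remove i g) y) y <= D (a (remove i g) x) x.
  by apply: Kx Ty; exists (remove i g) => //=; exact: remove_id.
rewrite [in a g y](single_remove i g) actM.
have := metric_triangle (a (single (g i)) (a (remove i g) y)) (a (single (g i)) y) y.
rewrite act_isometry; lra.
Qed.

Variable Z : set X.
Hypothesis mZ : minimal_inv (range a) Z.

Let cZ : ccvx Z. Proof. by case: mZ. Qed.

Let Za g z : Z z -> Z (a g z).
Proof. by move=> Zz; case: mZ => _ iZ _; apply: iZ => //; exists g. Qed.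

Lemma factor_splitting i : exists A f q,
  [/\ minimal_inv (factor a i) A, A `<=` Z
    & splitting (factor a i) (cofactor a i) Z A f q].
Proof.
apply: (two_factor_splitting completeX catX
  (@isometries_factor _ _ _ _ a i) (@isometries_cofactor _ _ _ _ a i)
  (@commuting_factor _ _ _ _ a i) (@tame_factor i) cZ).
- by move=> _ z [u _ <-]; exact: Za.
- by move=> _ z [g _ <-]; exact: Za.
- move=> C cC iHC iKC CZ; case: mZ => _ _; apply=> // _ z [g _ <-] Cz.
  rewrite (single_remove i g) actM; apply: iHC; first by exists (g i).
  by apply: iKC => //; exists (remove i g) => //=; exact: remove_id.
Qed.

Section Combination.
Variables (A : 'I_n -> set X) (f q : 'I_n -> X -> X).
Hypothesis Sp : forall i, splitting (factor a i) (cofactor a i) Z (A i) (f i) (q i).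

Let cofactor_act i g : g i = 1%g -> cofactor a i (a g).
Proof. by move=> gi; exists g. Qed.

Lemma splitting_f_act i g z : Z z -> f i (a g z) = a (single (g i)) (f i z).
Proof.
move=> Zz; rewrite (single_remove i g) actM (splitting_fH (Sp i)); last 2 first.
- by exists (g i).
- exact: Za.
rewrite (splitting_fK (Sp i))//; last exact/cofactor_act/remove_id.
by rewrite -single_remove.
Qed.

Lemma splitting_q_act i g z : Z z -> q i (a g z) = a (remove i g) (q i z).
Proof.
move=> Zz; rewrite {1}(single_remove i g) actM (splitting_qH (Sp i)); last 2 first.
- by exists (g i).
- exact: Za.
by rewrite (splitting_qK (Sp i))//; exact/cofactor_act/remove_id.
Qed.

Lemma splitting_f_le i z w : Z z -> Z w -> D (f i z) (f i w) <= D z w.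
Proof.
move=> Zz Zw; apply: sqr_le_le (mdist_ge0 _ _) _.
by rewrite (splitting_dist (Sp i) Zz Zw) lerDl sqr_ge0.
Qed.

Lemma splitting_q_le i z w : Z z -> Z w -> D (q i z) (q i w) <= D z w.
Proof.
move=> Zz Zw; apply: sqr_le_le (mdist_ge0 _ _) _.
by rewrite (splitting_dist (Sp i) Zz Zw) lerDr sqr_ge0.
Qed.

(* The distance between two affine maps that move by the same isometry under
   each g is constant on Z by minimality. *)
Lemma affine_dist_const (u v : X -> X) :
  (forall x y, Z x -> Z y -> D (u x) (u y) <= D x y) ->
  (forall x y, Z x -> Z y -> D (v x) (v y) <= D x y) ->
  (forall t x y m, Z x -> Z y -> 0 <= t <= 1 -> between t x y m ->
    between t (u x) (u y) (u m)) ->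
  (forall t x y m, Z x -> Z y -> 0 <= t <= 1 -> between t x y m ->
    between t (v x) (v y) (v m)) ->
  (forall g x, Z x -> D (u (a g x)) (v (a g x)) <= D (u x) (v x)) ->
  forall x y, Z x -> Z y -> D (u x) (v x) = D (u y) (v y).
Proof.
move=> uL vL ub vb uva.
apply: (@minimal_inv_const _ _ (range a) Z (fun x => D (u x) (v x)) 2 mZ).
- move=> x y Zx Zy; rewrite ler_norml.
  have := uL x y Zx Zy; have := vL x y Zx Zy.
  have := metric_triangle (u x) (u y) (v x); have := metric_triangle (u y) (v y) (v x).
  have := metric_triangle (u y) (u x) (v y); have := metric_triangle (u x) (v x) (v y).
  rewrite (metric_sym (u y) (u x)) (metric_sym (v y) (v x)); lra.
- move=> t x y m Zx Zy tI xm.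
  exact: (between_dist catX tI (ub _ _ _ _ Zx Zy tI xm) (vb _ _ _ _ Zx Zy tI xm)).
- by move=> _ x [g _ <-]; exact: uva.
Qed.

(** Both sides are affine in z and are moved by g through its i-th part only, so their distance is
    constant on Z; it vanishes at [q j z] as [q j] is idempotent. *)
Lemma splitting_fq i j z : i != j -> Z z -> f i (q j z) = f i z.
Proof.
move=> ij Zz; have qZ := splitting_q_in (Sp j).
have E := @affine_dist_const (fun y => f i (q j y)) (f i).
apply: mdist_positivity.
rewrite (E _ _ _ _ _ z (q j z)) ?(splitting_qq (Sp j))// ?mdistxx//.
- by move=> x y Zx Zy; apply: le_trans (splitting_f_le _ _ _) (splitting_q_le _ _ _);
    [exact: qZ|exact: qZ| |].
- by move=> x y; exact: splitting_f_le.
- move=> t x y m Zx Zy tI xm; apply: (splitting_f_between (Sp i)) => //.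
  + exact: qZ.
  + exact: qZ.
  + exact: (splitting_q_between (Sp j)).
- by move=> t x y m; exact: (splitting_f_between (Sp i)).
- move=> g x Zx; rewrite splitting_q_act// !splitting_f_act//; last exact: qZ.
  by rewrite remove_out 1?eq_sym// act_isometry.
- exact: qZ.
Qed.

Let c (s : seq 'I_n) z := foldr q z s.

Let c_in s z : Z z -> Z (c s z).
Proof. by move=> Zz; elim: s => //= i s IHs; exact: (splitting_q_in (Sp i)). Qed.

Let c_between s t x y m : Z x -> Z y -> 0 <= t <= 1 -> between t x y m ->
  between t (c s x) (c s y) (c s m).
Proof.
move=> Zx Zy tI xm; elim: s => //= i s IHs.
by apply: (splitting_q_between (Sp i)) => //; exact: c_in.
Qed.

Let c_le s x y : Z x -> Z y -> D (c s x) (c s y) <= D x y.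
Proof.
move=> Zx Zy; elim: s => //= i s; apply: le_trans.
by apply: splitting_q_le; exact: c_in.
Qed.

Let c_act s g z : Z z -> (forall j, j \in s -> g j = 1%g) ->
  c s (a g z) = a g (c s z).
Proof.
move=> Zz; elim: s => //= i s IHs gs; rewrite IHs; last first.
  by move=> j js; apply: gs; rewrite inE js orbT.
rewrite (splitting_qK (Sp i)) //; last exact: c_in.
by apply: cofactor_act; apply: gs; rewrite mem_head.
Qed.

(** For the head i of the list, the i-th part of g passes through the retractions of the tail and is
    absorbed by [q i]; the rest of g is absorbed by the tail, by induction. *)
Let c_inv s g z : uniq s -> Z z -> (forall j, j \notin s -> g j = 1%g) ->
  c s (a g z) = c s z.
Proof.
elim: s g z => [|i s IHs] g z /=.
  move=> _ Zz g1; suff -> : g = 1%g by rewrite act1.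
  by apply: functional_extensionality_dep => j; exact: g1.
move=> /andP[iNs us] Zz gs; rewrite (remove_single i g) actM.
rewrite IHs//; [|exact: Za|]; last first.
  move=> j js; have [<-|ij] := eqVneq i j; first exact: remove_id.
  by rewrite remove_out//; apply: gs; rewrite inE negb_or eq_sym ij.
rewrite c_act//; last first.
  by move=> j js; apply: dfwithout; apply: contraNneq iNs => ->.
by apply: (splitting_qH (Sp i)); [exists (g i)|exact: c_in].
Qed.

Let f_c i s z : i \notin s -> Z z -> f i (c s z) = f i z.
Proof.
move=> + Zz; elim: s => //= j s IHs; rewrite inE negb_or => /andP[ij /IHs <-].
by rewrite splitting_fq//; exact: c_in.
Qed.

Let c_dist s z w : uniq s -> Z z -> Z w ->
  D z w ^+ 2 = \sum_(i <- s) D (f i z) (f i w) ^+ 2 + D (c s z) (c s w) ^+ 2.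
Proof.
move=> + Zz Zw; elim: s => [|i s IHs] /=; first by rewrite big_nil add0r.
move=> /andP[iNs /IHs ->]; rewrite big_cons.
rewrite (splitting_dist (Sp i) (c_in s Zz) (c_in s Zw)) !f_c//.
by rewrite addrCA addrA.
Qed.

(** The composite of all retractions is affine and invariant under the whole group, so its distance
    to a constant map is constant: it collapses Z to a point, and [c_dist] leaves no remainder. *)
Lemma splitting_dist_sum z w : Z z -> Z w ->
  D z w ^+ 2 = \sum_i D (f i z) (f i w) ^+ 2.
Proof.
move=> Zz Zw; rewrite (c_dist (enum_uniq 'I_n) Zz Zw) big_enum /=.
suff -> : D (c (enum 'I_n) z) (c (enum 'I_n) w) = 0 by rewrite expr0n addr0.
rewrite (@affine_dist_const (c (enum 'I_n)) (fun=> c (enum 'I_n) w) _ _ _ _ _ z w)//.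
- by rewrite mdistxx.
- by move=> x y; exact: c_le.
- by move=> x y _ _; rewrite mdistxx mdist_ge0.
- by move=> t x y m; exact: c_between.
- by move=> t x y m _ _ _ _; split; rewrite mdistxx mulr0.
- move=> g x Zx; rewrite c_inv ?enum_uniq// => j.
  by rewrite mem_enum.
Qed.

(** Coordinates are corrected one at a time; by [splitting_fq], moving a point within a fibre of
    [q i] leaves the other coordinates unchanged. *)
Lemma splitting_f_onto (b : 'I_n -> X) : (forall i, A i (b i)) ->
  exists2 z, Z z & forall i, f i z = b i.
Proof.
move=> Ab.
suff [z Zz Hz] : exists2 z, Z z & forall i, i \in enum 'I_n -> f i z = b i.
  by exists z => // i; apply: Hz; rewrite mem_enum.
elim: (enum 'I_n) => [|i s [z Zz Hz]]; first by have [[z Zz] _ _] := cZ; exists z.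
have [z' Zz' [fz' qz']] := splitting_surj (Sp i) (Ab i) Zz.
exists z' => // j; rewrite inE; have [->//|ji /= js] := eqVneq j i.
by rewrite -(splitting_fq ji Zz') qz' (splitting_fq ji Zz); exact: Hz.
Qed.

End Combination.
End Splitting.

(** * Factor actions on the pieces and the conclusion *)

Section SubmetricAction.
Variables (R : realType) (n : nat) (G : 'I_n -> topGroupType) (X : metricType R).
Variables (a : isometric_action (prod_topology G) X) (i : 'I_n) (A : set X).
Hypothesis iA : inv_under (factor a i) A.

Definition sub_act (u : G i) (y : submetric A) : submetric A :=
  SigSub (mem_set (iA (ex_intro2 _ _ u I erefl) (set_mem (valP y)))).

Let sub_act1 y : sub_act 1%g y = y.
Proof. by apply: val_inj; rewrite /= single1 act1. Qed.

Let sub_actM u v y : sub_act (u * v)%g y = sub_act u (sub_act v y).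
Proof. by apply: val_inj; rewrite /= singleM actM. Qed.

Let sub_act_isometry u x y : mdist (sub_act u x) (sub_act u y) = mdist x y.
Proof. exact: act_isometry. Qed.

Definition sub_action : isometric_action (G i) (submetric A) :=
  IsometricAction sub_act1 sub_actM sub_act_isometry.

End SubmetricAction.

Lemma minimal_splits_equivariantly (R : realType) (n : nat)
    (G : 'I_n -> topGroupType) (X : metricType R)
    (a : isometric_action (prod_topology G) X) (Z : set X) :
  complete_space X -> CAT0 X -> continuous_action a -> ~ evanescent a ->
  minimal_inv (range a) Z -> splits_equivariantly a Z.
Proof.
move=> completeX catX contA nea mZ.
have [S HS] := choice (fun i => factor_splitting completeX catX contA nea mZ i).
have [F HF] := choice HS; have [Q HQ] := choice HF.
have Sp i : splitting (factor a i) (cofactor a i) Z (S i) (F i) (Q i).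
  by have [_ _] := HQ i.
have iS i : inv_under (factor a i) (S i) by have [[]] := HQ i.
have [[[z0 Zz0] _ _] _ _] := mZ.
(* The default of [insubd], never taken on Z. *)
pose y0 i : submetric (S i) := SigSub (mem_set (splitting_f_in (Sp i) Zz0)).
pose f x i : submetric (S i) := insubd (y0 i) (F i x).
have fE x i : Z x -> val (f x i) = F i x.
  by move=> Zx; apply: insubdK; apply: mem_set; exact: (splitting_f_in (Sp i)).
have fdist x y : Z x -> Z y -> l2_dist (f x) (f y) = mdist x y.
  move=> Zx Zy; rewrite /l2_dist /l2norm -[RHS]ger0_norm ?mdist_ge0// -sqrtr_sqr.
  rewrite (splitting_dist_sum catX mZ Sp Zx Zy); congr Num.sqrt.
  by apply: eq_bigr => i _; rewrite -(fE x i Zx) -(fE y i Zy).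
exists (fun i => submetric (S i)), (fun i => sub_action (iS i)), f; split=> //.
- split=> //.
  + move=> x y /set_mem Zx /set_mem Zy fxy; apply: mdist_positivity.
    rewrite -(fdist x y Zx Zy) fxy /l2_dist /l2norm big1 ?sqrtr0// => i _.
    by rewrite mdistxx expr0n.
  + move=> b _; have Sb i : S i (val (b i)) by exact: set_mem (valP (b i)).
    have [z Zz zb] := splitting_f_onto catX mZ Sp Sb; exists z => //.
    apply: functional_extensionality_dep => i; apply: val_inj.
    by rewrite fE.
- move=> g x Zx; apply: functional_extensionality_dep => i; apply: val_inj.
  have Zgx : Z (a g x) by case: mZ => _ iZ _; apply: iZ => //; exists g.
  by rewrite fE// (splitting_f_act mZ Sp)//= fE.
Qed.

(** [center] sees only the set of isometries, which an isomorphism of actions conjugates;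
    surjectivity of [psi] matches the maps in both directions. *)
Lemma center_canonical (R : realType) :
  canonical_assignment (fun G X (a : isometric_action G X) => @center R X (range a)).
Proof.
move=> G H X Y a b psi phi [[_ [psi' [_ psi'K _ _]]] [[phi' phiK phi'K] phii] equi].
apply: (@center_transport _ _ _ _ _ phi phi'); split=> //.
- by move=> _ [g _ <-]; exists (b (psi g)).
- by move=> _ [h _ <-]; exists (a (psi' h)) => // x; rewrite equi psi'K.
Qed.

Theorem theorem9 (R : realType) :
  exists Z : subset_assignment R,
    canonical_assignment Z /\
    forall (n : nat) (G : 'I_n -> topGroupType) (X : metricType R)
      (a : isometric_action (prod_topology G) X),
      [set: X] !=set0 -> complete_space X -> CAT0 X -> continuous_action a ->
      evanescent a \/
      [/\ Z _ X a !=set0, closed (Z _ X a), geodesically_convex (Z _ X a),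
          invariant_set a (Z _ X a) & splits_equivariantly a (Z _ X a)].
Proof.
exists (fun G X a => center (range a)); split; first exact: center_canonical.
move=> n G X a X0 completeX catX contA.
have [eva|nea] := pselect (evanescent a); [by left|right].
have mZ : minimal_inv (range a) (center (range a)).
  exact: (center_minimal completeX catX (@isometries_act _ _ _ _ a)
    (tame_act contA nea) X0).
have [[Z0 clZ cvZ] iZ _] := mZ; split=> //.
- exact/closed_mclosed.
- exact: bconvex_geodesically_convex.
- by move=> g x Zx; apply: iZ => //; exists g.
- exact: minimal_splits_equivariantly.
Qed.
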